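(* Let $G$ and $H$ be two groups such that $$G^{ab}\otimes H^{ab}=M^{(1)}(G)\otimes H^{ab}=M^{(1)}(H)\otimes G^{ab}=\mathrm{Tor}(G^{ab},H^{ab})=0.$$ Then for all $c\ge 1$ there is an isomorphism $$M^{(c)}(G\ast H)\cong M^{(c)}(G)\oplus M^{(c)}(H).$$
   Context: For a group $G$ with free presentation $G\cong F/R$ ($F$ a free group, $R$ a normal subgroup) and an integer $c\ge 1$, the $c$-nilpotent multiplier of $G$ is $$M^{(c)}(G)=\frac{R\cap\gamma_{c+1}(F)}{[R,\ {}_cF]},$$ where $\gamma_{c+1}(F)$ is the $(c+1)$-st term of the lower central series of $F$ (with $\gamma_1(F)=F$), $[R,\ {}_1F]=[R,F]$ and inductively $[R,\ {}_cF]=[[R,\ {}_{c-1}F],F]$. It is an abelian group which, up to isomorphism, does not depend on the chosen free presentation. $M^{(1)}(G)$ is the Schur multiplier of $G$, isomorphic to $H_2(G,\mathbb{Z})$. $G\ast H$ denotes the free product, $G^{ab}$ the abelianization of $G$, and $\otimes$ and $\mathrm{Tor}$ are taken over $\mathbb{Z}$ ($\mathrm{Tor}=\mathrm{Tor}_1^{\mathbb{Z}}$). *)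

(* Defs.v *)
From HB Require Import structures.
From mathcomp Require Import all_boot all_algebra.
From mathcomp Require Import boolp.
From mathcomp.multinomials Require Import freeg.

Set Implicit Arguments.
Unset Strict Implicit.
Unset Printing Implicit Defensive.

Import GRing.Theory.

Local Open Scope quotient_scope.
Local Open Scope group_scope.

(* Groups given by generators and relations: words over an alphabet A with a
   formal inverse i, modulo the congruence generated by r and by the
   cancellations a (i a) = 1 = (i a) a. *)
Section PresentedGroup.
Variables (A : choiceType) (i : A -> A) (r : seq A -> seq A -> Prop).
Implicit Types s t u v w : seq A.

Inductive word_step : seq A -> seq A -> Prop :=
| WordRel s t : r s t -> word_step s t
| WordCancelR a : word_step [:: a; i a] [::]
| WordCancelL a : word_step [:: i a; a] [::].

Inductive word_cong : seq A -> seq A -> Prop :=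
| WordStep u v s t : word_step s t -> word_cong (u ++ s ++ v) (u ++ t ++ v)
| WordRefl s : word_cong s s
| WordSym s t : word_cong s t -> word_cong t s
| WordTrans s t w : word_cong s t -> word_cong t w -> word_cong s w.

Definition word_equiv : rel (seq A) := fun s t => `[< word_cong s t >].

Lemma word_equiv_class : equiv_class_of word_equiv.
Proof.
split=> [s|s t|t s w].
- exact/asboolP/WordRefl.
- by apply/asboolP/asboolP; apply: WordSym.
- by move=> /asboolP st /asboolP tw; apply/asboolP; apply: WordTrans st tw.
Qed.

Canonical word_equiv_equiv := EquivRelPack word_equiv_class.
Canonical word_equiv_encModRel := defaultEncModRel word_equiv.

Definition presented_group := {eq_quot word_equiv}.
HB.instance Definition _ : EqQuotient _ word_equiv presented_group :=
  EqQuotient.on presented_group.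
HB.instance Definition _ := Choice.on presented_group.

Definition of_word s : presented_group := \pi_presented_group s.

Lemma of_wordP s t : of_word s = of_word t <-> word_cong s t.
Proof. by split=> [/eqmodP/asboolP|st]; last exact/eqmodP/asboolP. Qed.

Lemma word_cong_cat s s' t t' :
  word_cong s s' -> word_cong t t' -> word_cong (s ++ t) (s' ++ t').
Proof.
have congr u v w w' : word_cong w w' -> word_cong (u ++ w ++ v) (u ++ w' ++ v).
  elim=> [u' v' w1 w2 st|w1|w1 w2 _|w1 w2 w3 _ + _].
  - by rewrite -!catA !(catA u u') ; apply: WordStep.
  - exact: WordRefl.
  - exact: WordSym.
  - exact: WordTrans.
move=> ss' tt'; apply: (@WordTrans _ (s' ++ t)).
  exact: (congr [::] t).
by have := congr s' [::] _ _ tt'; rewrite !cats0.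
Qed.

Definition word_inv s : seq A := rev (map i s).

Lemma word_cong_invr s : word_cong (s ++ word_inv s) [::].
Proof.
elim/last_ind: s => [|s a IHs]; first exact: WordRefl.
rewrite /word_inv map_rcons rev_rcons -cats1 -catA -cat1s.
apply: WordTrans IHs; have := WordStep s (word_inv s) (WordCancelR a).
by rewrite /= -cat1s.
Qed.

Lemma word_cong_invl s : word_cong (word_inv s ++ s) [::].
Proof.
elim: s => [|a s IHs]; first exact: WordRefl.
rewrite /word_inv map_cons rev_cons -cats1 -catA.
by apply: WordTrans IHs; exact: (WordStep (word_inv s) s (WordCancelL a)).
Qed.

Definition pg_mul (x y : presented_group) := of_word (repr x ++ repr y).
Definition pg_inv (x : presented_group) := of_word (word_inv (repr x)).
Definition pg_one := of_word [::].

Lemma repr_of_word s : word_cong (repr (of_word s)) s.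
Proof. by apply/of_wordP; rewrite /of_word reprK. Qed.

Lemma of_word_cat s t : pg_mul (of_word s) (of_word t) = of_word (s ++ t).
Proof. by apply/of_wordP/word_cong_cat; exact: repr_of_word. Qed.

Lemma of_wordE x : x = of_word (repr x). Proof. by rewrite /of_word reprK. Qed.

Lemma pg_mulA : associative pg_mul.
Proof.
by move=> x y z; rewrite (of_wordE x) (of_wordE y) (of_wordE z) !of_word_cat catA.
Qed.

Lemma pg_mul1 : left_id pg_one pg_mul.
Proof. by move=> x; rewrite (of_wordE x) of_word_cat. Qed.

Lemma pg_1mul : right_id pg_one pg_mul.
Proof. by move=> x; rewrite (of_wordE x) of_word_cat cats0. Qed.

Lemma pg_mulV : left_inverse pg_one pg_inv pg_mul.
Proof.
move=> x; rewrite {2}(of_wordE x) of_word_cat.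
exact/of_wordP/word_cong_invl.
Qed.

Lemma pg_mulgV : right_inverse pg_one pg_inv pg_mul.
Proof.
move=> x; rewrite {1}(of_wordE x) of_word_cat.
exact/of_wordP/word_cong_invr.
Qed.

HB.instance Definition _ :=
  isGroup.Build presented_group pg_mulA pg_mul1 pg_1mul pg_mulV pg_mulgV.

End PresentedGroup.

(* The letter (b, x) stands for x if b = true and for its inverse otherwise. *)
Definition free_group (X : choiceType) : groupType :=
  @presented_group (bool * X)%type (fun a => (~~ a.1, a.2)) (fun _ _ => False).

Section FreeProduct.
Variables G H : groupType.

Inductive free_product_rel : seq (G + H) -> seq (G + H) -> Prop :=
| FPoneL : free_product_rel [:: inl 1] [::]
| FPoneR : free_product_rel [:: inr 1] [::]
| FPmulL x y : free_product_rel [:: inl x; inl y] [:: inl (x * y)]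
| FPmulR x y : free_product_rel [:: inr x; inr y] [:: inr (x * y)].

Definition free_product : groupType :=
  @presented_group (G + H)%type
    (fun a => match a with inl x => inl x^-1 | inr y => inr y^-1 end)
    free_product_rel.

End FreeProduct.

Section Subgroups.
Variable G : groupType.

Definition generated (S : G -> Prop) : {pred G} :=
  fun x => `[< forall K : groupClosed G, (forall y, S y -> y \in K) -> x \in K >].

Lemma generatedP (S : G -> Prop) x :
  reflect (forall K : groupClosed G, (forall y, S y -> y \in K) -> x \in K)
          (x \in generated S).
Proof. exact: asboolP. Qed.

Lemma generated_mul (S : G -> Prop) : mulg_closed (generated S).
Proof.
move=> x y /generatedP Sx /generatedP Sy; apply/generatedP=> K SK.
by apply: gpredM; [apply: Sx|apply: Sy].
Qed.

Lemma generated_one (S : G -> Prop) : 1 \in generated S.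
Proof. by apply/generatedP=> K _; exact: gpred1. Qed.

Lemma generated_inv (S : G -> Prop) : invg_closed (generated S).
Proof.
by move=> x /generatedP Sx; apply/generatedP=> K SK; apply: gpredVr; apply: Sx.
Qed.

HB.instance Definition _ S := isMulClosed.Build G (generated S) (@generated_mul S).
HB.instance Definition _ S := isMul1Closed.Build G (generated S) (generated_one S).
HB.instance Definition _ S := isInvClosed.Build G (generated S) (@generated_inv S).

Lemma mem_generated (S : G -> Prop) x : S x -> x \in generated S.
Proof. by move=> Sx; apply/generatedP=> K; apply. Qed.

Definition whole : {pred G} := predT.
HB.instance Definition _ := isMulClosed.Build G whole (fun _ _ _ _ => isT).
HB.instance Definition _ := isMul1Closed.Build G whole isT.
HB.instance Definition _ := isInvClosed.Build G whole (fun _ _ => isT).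

Definition subgroupI (A B : groupClosed G) : {pred G} := [predI A & B].

Section SubgroupI.
Variables A B : groupClosed G.

Lemma subgroupI_mul : mulg_closed (subgroupI A B).
Proof.
by move=> x y /andP[Ax Bx] /andP[Ay By]; apply/andP; split; exact: gpredM.
Qed.
Lemma subgroupI_one : 1 \in subgroupI A B.
Proof. by apply/andP; split; exact: gpred1. Qed.
Lemma subgroupI_inv : invg_closed (subgroupI A B).
Proof. by move=> x /andP[Ax Bx]; apply/andP; split; exact: gpredVr. Qed.

HB.instance Definition _ := isMulClosed.Build G (subgroupI A B) subgroupI_mul.
HB.instance Definition _ := isMul1Closed.Build G (subgroupI A B) subgroupI_one.
HB.instance Definition _ := isInvClosed.Build G (subgroupI A B) subgroupI_inv.
End SubgroupI.

Definition commutator (A B : groupClosed G) : groupClosed G :=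
  generated (fun z => exists x y, [/\ x \in A, y \in B & z = [~ x, y]]).

(* [R, _cG], with c nested commutators *)
Definition iter_commutator (R : groupClosed G) (c : nat) : groupClosed G :=
  iter c (fun A => commutator A whole) R.

(* n-th term of the lower central series, indexed from n = 1 *)
Definition gamma (n : nat) : groupClosed G := iter_commutator whole n.-1.

End Subgroups.

Arguments whole G : clear implicits.

Section Kernel.
Variables (G H : groupType) (f : {multiplicative G -> H}).

Definition kernel : {pred G} := fun x => f x == 1.

Lemma hom_one : f 1 = 1.
Proof. by apply: (@mulgI _ (f 1)); rewrite -gmulfM !mulg1. Qed.

Lemma hom_inv x : f x^-1 = (f x)^-1.
Proof. by apply: (@mulgI _ (f x)); rewrite -gmulfM !mulgV hom_one. Qed.

Lemma kernel_mul : mulg_closed kernel.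
Proof.
by move=> x y /eqP fx /eqP fy; apply/eqP; rewrite gmulfM fx fy mulg1.
Qed.
Lemma kernel_one : 1 \in kernel. Proof. exact/eqP/hom_one. Qed.
Lemma kernel_inv : invg_closed kernel.
Proof. by move=> x /eqP fx; apply/eqP; rewrite hom_inv fx invg1. Qed.

HB.instance Definition _ := isMulClosed.Build G kernel kernel_mul.
HB.instance Definition _ := isMul1Closed.Build G kernel kernel_one.
HB.instance Definition _ := isInvClosed.Build G kernel kernel_inv.

Lemma kernel_conj x y : x \in kernel -> x ^ y \in kernel.
Proof.
move=> /eqP fx; apply/eqP; rewrite /conjg !gmulfM fx mul1g.
by rewrite -gmulfM mulVg hom_one.
Qed.

End Kernel.

Section SubgroupType.
Variables (G : groupType) (A : groupClosed G).

Record subgroup_of := SubgroupOf { subgroup_val : G; _ : subgroup_val \in A }.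
HB.instance Definition _ := [isSub for subgroup_val].
HB.instance Definition _ := [Choice of subgroup_of by <:].

Lemma subgroup_of_closed : group_closed A.
Proof. by split; [exact: gpred1|exact: gpredF]. Qed.
HB.instance Definition _ :=
  SubChoice_isSubGroup.Build G _ subgroup_of subgroup_of_closed.

(* B as a subgroup of A; used when B is contained in A *)
Definition restrict (B : groupClosed G) : {pred subgroup_of} :=
  fun x => val x \in B.

Section Restrict.
Variable B : groupClosed G.
Lemma restrict_mul : mulg_closed (restrict B).
Proof. by move=> x y Bx By; rewrite unfold_in valM; exact: gpredM. Qed.
Lemma restrict_one : 1 \in restrict B.
Proof. by rewrite unfold_in val1; exact: gpred1. Qed.
Lemma restrict_inv : invg_closed (restrict B).
Proof.
move=> x Bx; rewrite unfold_in; suff -> : val x^-1 = (val x)^-1 by exact: gpredVr.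
by apply: (@mulgI _ (val x)); rewrite -valM !mulgV val1.
Qed.
HB.instance Definition _ := isMulClosed.Build subgroup_of (restrict B) restrict_mul.
HB.instance Definition _ := isMul1Closed.Build subgroup_of (restrict B) restrict_one.
HB.instance Definition _ := isInvClosed.Build subgroup_of (restrict B) restrict_inv.
End Restrict.

End SubgroupType.

(* K / N for a subgroup N that contains all commutators of K (hence is normal);
   this quotient is abelian and is written additively. *)
Section AbelianQuotient.
Variables (K : groupType) (N : groupClosed K).
Hypothesis commN : forall x y : K, [~ x, y] \in N.

Lemma commN_conj x y : x \in N -> x ^ y \in N.
Proof.
move=> Nx; have -> : x ^ y = x * [~ x, y] by rewrite /commg !mulgA mulgV mul1g /conjg mulgA.
exact: gpredM.
Qed.

Definition coset_equiv (_ : forall x y : K, [~ x, y] \in N) : rel K :=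
  fun x y => x^-1 * y \in N.
Local Notation equiv := (coset_equiv commN).

Lemma coset_equiv_class : equiv_class_of equiv.
Proof.
split=> [x|x y|y x z]; rewrite /coset_equiv.
- by rewrite mulVg gpred1.
- by rewrite -gpredV invgM invgK.
- by move=> Nxy Nyz; rewrite -(mulgK y x^-1) -mulgA gpredM.
Qed.

Canonical coset_equiv_equiv := EquivRelPack coset_equiv_class.
Canonical coset_equiv_encModRel := defaultEncModRel equiv.

Definition abelian_quotient := {eq_quot equiv}.
HB.instance Definition _ : EqQuotient K equiv abelian_quotient :=
  EqQuotient.on abelian_quotient.
HB.instance Definition _ := Choice.on abelian_quotient.

Definition abq (x : K) : abelian_quotient := \pi_abelian_quotient x.

Lemma abqP x y : abq x = abq y <-> x^-1 * y \in N.
Proof. by split=> [/eqmodP|Nxy]; last exact/eqmodP. Qed.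

Lemma abqK x : abq (repr x) = x. Proof. exact: reprK. Qed.

Definition abq_add (x y : abelian_quotient) := abq (repr x * repr y).
Definition abq_opp (x : abelian_quotient) := abq (repr x)^-1.

Lemma abq_addE x y : abq_add (abq x) (abq y) = abq (x * y).
Proof.
have /abqP Nx := abqK (abq x); have /abqP Ny := abqK (abq y).
apply/abqP; move: Nx Ny; set x' := repr (abq x); set y' := repr (abq y).
move=> Nx Ny.
suff -> : (x' * y')^-1 * (x * y) = (x'^-1 * x) ^ y' * (y'^-1 * y).
  by apply: gpredM => //; exact: commN_conj.
by rewrite /conjg invgM !mulgA mulgK.
Qed.

Lemma abq_oppE x : abq_opp (abq x) = abq x^-1.
Proof.
have /abqP Nx := abqK (abq x); apply/abqP.
move: Nx; set x' := repr (abq x) => Nx.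
suff -> : x'^-1^-1 * x^-1 = ((x'^-1 * x)^-1) ^ x'^-1.
  by apply/commN_conj/gpredVr.
by rewrite /conjg invgM !invgK !mulgA mulgK.
Qed.

Lemma abq_addA : associative abq_add.
Proof.
by move=> x y z; rewrite -(abqK x) -(abqK y) -(abqK z) !abq_addE mulgA.
Qed.

Lemma abq_addC : commutative abq_add.
Proof.
move=> x y; rewrite -(abqK x) -(abqK y) !abq_addE; apply/abqP.
by rewrite invgM -mulgA; exact: commN.
Qed.

Lemma abq_add0 : left_id (abq 1) abq_add.
Proof. by move=> x; rewrite -(abqK x) abq_addE mul1g. Qed.

Lemma abq_addN : left_inverse (abq 1) abq_opp abq_add.
Proof. by move=> x; rewrite -(abqK x) abq_oppE abq_addE mulVg. Qed.

HB.instance Definition _ :=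
  GRing.isZmodule.Build abelian_quotient abq_addA abq_addC abq_add0 abq_addN.

End AbelianQuotient.

Section Abelianization.
Variable G : groupType.

Lemma mem_commutator (A B : groupClosed G) x y :
  x \in A -> y \in B -> [~ x, y] \in commutator A B.
Proof. by move=> Ax By; apply: mem_generated; exists x, y. Qed.

Lemma derived_comm (x y : G) : [~ x, y] \in commutator (whole G) (whole G).
Proof. exact: mem_commutator. Qed.

Definition abelianization : zmodType := abelian_quotient derived_comm.

End Abelianization.

Record free_presentation (G : groupType) := FreePresentation {
  fp_gens : choiceType;
  fp_map : {multiplicative free_group fp_gens -> G};
  fp_surj : forall g, exists x, fp_map x = g
}.

Section CommutatorTheory.
Variable F : groupType.
Implicit Types A B N : groupClosed F.

Definition is_normal A := forall x y, x \in A -> x ^ y \in A.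

Lemma commutator_min A B N :
  (forall x y, x \in A -> y \in B -> [~ x, y] \in N) ->
  forall z, z \in commutator A B -> z \in N.
Proof. by move=> ABN z /generatedP; apply=> _ [x [y [Ax By ->]]]; exact: ABN. Qed.

Lemma whole_normal : is_normal (whole F). Proof. by []. Qed.

Section ConjPreim.
Variables (N : groupClosed F) (y : F).
Definition conj_preim : {pred F} := fun x => x ^ y \in N.
Lemma conj_preim_mul : mulg_closed conj_preim.
Proof. by move=> a b Na Nb; rewrite unfold_in conjMg; exact: gpredM. Qed.
Lemma conj_preim_one : 1 \in conj_preim.
Proof. by rewrite unfold_in conj1g; exact: gpred1. Qed.
Lemma conj_preim_inv : invg_closed conj_preim.
Proof. by move=> a Na; rewrite unfold_in conjVg; exact: gpredVr. Qed.
HB.instance Definition _ := isMulClosed.Build F conj_preim conj_preim_mul.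
HB.instance Definition _ := isMul1Closed.Build F conj_preim conj_preim_one.
HB.instance Definition _ := isInvClosed.Build F conj_preim conj_preim_inv.
End ConjPreim.

Lemma commutator_normal A B :
  is_normal A -> is_normal B -> is_normal (commutator A B).
Proof.
move=> nA nB x y; apply: (commutator_min (N := conj_preim (commutator A B) y)).
move=> a b Aa Bb; rewrite unfold_in conjRg.
by apply: mem_commutator; [exact: nA|exact: nB].
Qed.

Lemma iter_commutator_normal A c : is_normal A -> is_normal (iter_commutator A c).
Proof. by move=> nA; elim: c => //= c IHc; exact: commutator_normal whole_normal. Qed.

Lemma Hall_Witt (x y z : F) :
  [~ x, y^-1, z] ^ y * [~ y, z^-1, x] ^ z * [~ z, x^-1, y] ^ x = 1.
Proof.
pose a (x y z : F) := x * z * y ^ x.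
suffices {x y z} hw_aux x y z : [~ x, y^-1, z] ^ y = (a x y z)^-1 * (a y z x).
  by rewrite !hw_aux; move: a {hw_aux} => a; rewrite 2!mulgA !mulgK mulVg.
rewrite /a /commg /conjg !invgM !invgK !mulgA.
by rewrite mulVg mul1g.
Qed.

(* y such that [x, y] lies in the normal subgroup N for every x in A *)
Section Centralized.
Variables (A N : groupClosed F) (nN : is_normal N).
Definition centralized (_ : is_normal N) : {pred F} :=
  fun y => `[< forall x, x \in A -> [~ x, y] \in N >].
Lemma centralizedP y :
  reflect (forall x, x \in A -> [~ x, y] \in N) (y \in centralized nN).
Proof. exact: asboolP. Qed.
Lemma centralized_mul : mulg_closed (centralized nN).
Proof.
move=> a b /centralizedP Na /centralizedP Nb; apply/centralizedP=> x Ax.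
have -> : [~ x, a * b] = [~ x, b] * [~ x, a] ^ b.
  by rewrite /commg /conjg !invgM !mulgA !(mulVg, mulgV, mul1g, mulgK, mulgVK).
by apply: gpredM; [exact: Nb|exact/nN/Na].
Qed.
Lemma centralized_one : 1 \in centralized nN.
Proof. by apply/centralizedP=> x Ax; rewrite commg1 gpred1. Qed.
Lemma centralized_inv : invg_closed (centralized nN).
Proof.
move=> a /centralizedP Na; apply/centralizedP=> x Ax.
have -> : [~ x, a^-1] = ([~ x, a]^-1) ^ a^-1.
  by rewrite /commg /conjg !invgM !invgK !mulgA !(mulVg, mulgV, mul1g, mulgK, mulgVK).
by apply/nN/gpredVr/Na.
Qed.
HB.instance Definition _ := isMulClosed.Build F (centralized nN) centralized_mul.
HB.instance Definition _ := isMul1Closed.Build F (centralized nN) centralized_one.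
HB.instance Definition _ := isInvClosed.Build F (centralized nN) centralized_inv.
End Centralized.

Lemma iter_commutator_sub A c : is_normal A ->
  forall x, x \in iter_commutator A c.+1 -> x \in iter_commutator A c.
Proof.
move=> nA; apply: commutator_min => x y Ax _; rewrite commgEl.
by apply: gpredM; [exact: gpredVr|exact: iter_commutator_normal].
Qed.

(* [[R, _jF], gamma_{k+1}(F)] is contained in [R, _{j+k+1}F] *)
Lemma iter_commutator_gamma A j k : is_normal A ->
  forall x y, x \in iter_commutator A j -> y \in gamma F k.+1 ->
  [~ x, y] \in iter_commutator A (j + k).+1.
Proof.
move=> nA; elim: k j => [|k IHk] j x y Ax gy.
  by rewrite addn0; exact: mem_commutator.
have nN := @iter_commutator_normal A (j + k.+1).+1 nA.
suff /centralizedP : y \in centralized (iter_commutator A j) nN by apply.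
move: y gy; apply: commutator_min => y z gy _; apply/centralizedP => {}x {}Ax.
rewrite -invgR; apply: gpredVr; set N := iter_commutator A _ in nN *.
have N1 : [~ z^-1, x^-1, y] ^ x \in N.
  apply: nN; rewrite /N addnS -addSn; apply: IHk => //.
  rewrite -invgR; apply/gpredVr/mem_commutator => //; exact: gpredVr.
have N2 : [~ x, y^-1, z^-1] ^ y \in N.
  apply: nN; rewrite /N addnS; apply: mem_commutator => //.
  by apply: IHk => //; exact: gpredVr.
have : 1 \in N by exact: gpred1.
rewrite -(Hall_Witt x y z^-1) invgK gpredMr // gpredMl // => N3.
by rewrite -(conjgK z^-1 [~ y, z, x]); apply: nN.
Qed.

End CommutatorTheory.

Section NilpotentMultiplier.
Variables (G : groupType) (P : free_presentation G) (c : nat).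

Local Notation F := (free_group (fp_gens P)).

(* R, so that G is isomorphic to F / R *)
Definition relators : groupClosed F := kernel (fp_map P).

Definition multiplier_num : groupClosed F := subgroupI relators (gamma F c.+1).
Definition multiplier_den : groupClosed F := iter_commutator relators c.

Lemma relators_normal : is_normal relators.
Proof. by move=> x y; exact: kernel_conj. Qed.

Lemma multiplier_den_sub x : x \in multiplier_den -> x \in multiplier_num.
Proof.
move=> Dx; apply/andP; split; move: x Dx; rewrite /multiplier_den.
  elim: c => //= n IHn x /(iter_commutator_sub relators_normal); exact: IHn.
elim: c => //= n IHn; apply: commutator_min => x y /IHn gx _.
exact: mem_commutator.
Qed.

Lemma multiplier_comm (x y : subgroup_of multiplier_num) :
  [~ x, y] \in restrict multiplier_den.
Proof.
have /andP[Rx _] := valP x; have /andP[_ gy] := valP y.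
have valV (z : subgroup_of multiplier_num) : val z^-1 = (val z)^-1.
  by apply: (@mulgI _ (val z)); rewrite -valM !mulgV val1.
rewrite unfold_in /commg /conjg !valM !valV.
apply: (iter_commutator_sub relators_normal).
exact: (@iter_commutator_gamma _ relators 0 c relators_normal _ _ Rx gy).
Qed.

(* M^(c)(G), computed from the free presentation P of G *)
Definition nilpotent_multiplier : zmodType := abelian_quotient multiplier_comm.

End NilpotentMultiplier.

Local Open Scope ring_scope.

Section SubmoduleGenerated.
Variable V : zmodType.

Definition zspan (S : V -> Prop) : {pred V} :=
  fun x => `[< forall K : zmodClosed V, (forall y, S y -> y \in K) -> x \in K >].

Lemma zspanP (S : V -> Prop) x :
  reflect (forall K : zmodClosed V, (forall y, S y -> y \in K) -> x \in K)
          (x \in zspan S).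
Proof. exact: asboolP. Qed.

Lemma zspan_closed (S : V -> Prop) : zmod_closed (zspan S).
Proof.
split; first by apply/zspanP=> K _; exact: rpred0.
move=> x y /zspanP Sx /zspanP Sy; apply/zspanP=> K SK.
by apply: rpredB; [apply: Sx|apply: Sy].
Qed.
HB.instance Definition _ S := GRing.isZmodClosed.Build V (zspan S) (zspan_closed S).

Lemma mem_zspan (S : V -> Prop) x : S x -> x \in zspan S.
Proof. by move=> Sx; apply/zspanP=> K; apply. Qed.

End SubmoduleGenerated.

Section AdditiveKernel.
Variables (U V : zmodType) (f : {additive U -> V}).

Definition additive_kernel : {pred U} := fun x => f x == 0.

Lemma additive_kernel_closed : zmod_closed additive_kernel.
Proof.
split; first by rewrite unfold_in raddf0.
by move=> x y /eqP fx /eqP fy; rewrite unfold_in raddfB fx fy subrr.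
Qed.
HB.instance Definition _ :=
  GRing.isZmodClosed.Build U additive_kernel additive_kernel_closed.

Record ker_of := KerOf { ker_val : U; _ : ker_val \in additive_kernel }.
HB.instance Definition _ := [isSub for ker_val].
HB.instance Definition _ := [Choice of ker_of by <:].
HB.instance Definition _ := [SubChoice_isSubZmodule of ker_of by <:].

End AdditiveKernel.

(* Additive extension of f : X -> V to the free abelian group on X *)
Section FreeAbelianLift.
Variables (X : choiceType) (V : zmodType) (f : X -> V).
Definition free_ab_lift (u : {freeg X / int}) : V :=
  fglift (f : X -> zmodule V) u.
Lemma free_ab_lift_additive : zmod_morphism free_ab_lift.
Proof. exact: (@lift_is_additive _ _ (zmodule V)). Qed.
HB.instance Definition _ :=
  GRing.isZmodMorphism.Build {freeg X / int} V free_ab_lift free_ab_lift_additive.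
Lemma free_ab_liftU x : free_ab_lift << x >> = f x.
Proof. by rewrite /free_ab_lift liftU scale1r. Qed.
End FreeAbelianLift.

Lemma zquot_eq0 (V : zmodType) (K : zmodClosed V) (x : V) :
  \pi_(Quotient.quot K) x = 0 <-> x \in K.
Proof.
have := Quotient.idealrBE K x 0; rewrite subr0 => ->.
by rewrite -[0 in X in X <-> _](raddf0 \pi_(Quotient.quot K)); split=> /eqP.
Qed.

Section TensorProduct.
Variables A B : zmodType.

Inductive bilinear_rel : {freeg (A * B) / int} -> Prop :=
| BilinearL a a' b :
    bilinear_rel (<< (a + a', b) >> - << (a, b) >> - << (a', b) >>)
| BilinearR a b b' :
    bilinear_rel (<< (a, b + b') >> - << (a, b) >> - << (a, b') >>).

(* A tensor B over Z *)
Definition tensor : zmodType := Quotient.quot (zspan bilinear_rel).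

Definition tensor_pi : {additive {freeg (A * B) / int} -> tensor} :=
  \pi_(Quotient.quot (zspan bilinear_rel)).

Definition tens (a : A) (b : B) : tensor := tensor_pi << (a, b) >>.

Lemma tensor_piK (t : tensor) : tensor_pi (repr t) = t.
Proof. exact: reprK. Qed.

Lemma tensor_pi_eq0 u : tensor_pi u = 0 <-> u \in zspan bilinear_rel.
Proof. exact: zquot_eq0. Qed.

Lemma tensDl a a' b : tens (a + a') b = tens a b + tens a' b.
Proof.
apply/eqP; rewrite -subr_eq0 opprD addrA /tens -!raddfB; apply/eqP/tensor_pi_eq0.
exact/mem_zspan/BilinearL.
Qed.

Lemma tensDr a b b' : tens a (b + b') = tens a b + tens a b'.
Proof.
apply/eqP; rewrite -subr_eq0 opprD addrA /tens -!raddfB; apply/eqP/tensor_pi_eq0.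
exact/mem_zspan/BilinearR.
Qed.

End TensorProduct.

(* f tensor B, which sends a tensor b to f a tensor b *)
Section TensorMap.
Variables (A A' B : zmodType) (f : {additive A -> A'}).

Definition tensor_map_free : {additive {freeg (A * B) / int} -> tensor A' B} :=
  free_ab_lift (fun ab => tens (f ab.1) ab.2).

Lemma tensor_map_freeU a b : tensor_map_free << (a, b) >> = tens (f a) b.
Proof. exact: (free_ab_liftU _ (a, b)). Qed.

Definition tensor_map (t : tensor A B) : tensor A' B := tensor_map_free (repr t).

Lemma tensor_map_pi u : tensor_map (tensor_pi A B u) = tensor_map_free u.
Proof.
apply/eqP; rewrite -subr_eq0 -raddfB; apply/eqP.
have : repr (tensor_pi A B u) - u \in zspan (@bilinear_rel A B).
  by apply/tensor_pi_eq0; rewrite raddfB tensor_piK subrr.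
move/zspanP=> /(_ (additive_kernel tensor_map_free)) Krel; apply/eqP/Krel.
move=> v [a a' b|a b b']; apply/eqP; rewrite 2!raddfB !tensor_map_freeU.
  by rewrite raddfD tensDl -addrA -opprD subrr.
by rewrite tensDr -addrA -opprD subrr.
Qed.

Lemma tensor_map_additive : zmod_morphism tensor_map.
Proof.
move=> s t; rewrite -(tensor_piK s) -(tensor_piK t) -raddfB !tensor_map_pi.
exact: raddfB.
Qed.
HB.instance Definition _ :=
  GRing.isZmodMorphism.Build (tensor A B) (tensor A' B) tensor_map
    tensor_map_additive.

Lemma tensor_mapE a b : tensor_map (tens a b) = tens (f a) b.
Proof. by rewrite /tens tensor_map_pi tensor_map_freeU. Qed.

End TensorMap.

(* Tor_1(A, B) as the kernel of R tensor B -> F tensor B, for the free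
   resolution 0 -> R -> F -> A -> 0 in which F is the free abelian group on the
   set A. *)
Section Tor.
Variables A B : zmodType.

Definition tor_cover : {additive {freeg A / int} -> A} := free_ab_lift id.

Definition tor_incl : {additive ker_of tor_cover -> {freeg A / int}} :=
  \val.

Definition Tor : zmodType := ker_of (@tensor_map _ _ B tor_incl).

End Tor.

Definition is_zero (V : zmodType) := forall x : V, x = 0.

(* Main.v *)
Require Import Defs.
From HB Require Import structures.
From mathcomp Require Import all_boot all_algebra.
From mathcomp Require Import boolp.
From mathcomp.multinomials Require Import freeg.

Set Implicit Arguments.
Unset Strict Implicit.
Unset Printing Implicit Defensive.

Import GRing.Theory.

Local Open Scope quotient_scope.
Local Open Scope group_scope.

(** Write G = F1/R1 and H = F2/R2 with F1 and F2 free, F for the free product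
    of F1 and F2, S for the kernel of F -> G * H, K for the kernel of
    F -> F1 x F2, S_n for [S, _n F] and gamma_n for gamma_n(F).

    The projections of F onto its factors induce a homomorphism from
    M^(c)(G * H) to the direct sum of M^(c)(G) and M^(c)(H), and the inclusions
    of the factors show that it is onto.  An element of S /\ gamma_(c+1)
    differs from the product of its two projections by an element of K, so
    injectivity amounts to the inclusion

      (I_c)   K /\ S /\ gamma_(c+1)  is contained in  S_c,

    which is [cartesian_multiplier] and is proved by induction on c.

    - c = 1: S is generated by R1, R2 and S_1, so that K /\ S is contained in
      S_1 whatever G and H are ([kernel_split]).

    - c = 2: S_1/S_2 is central in F/S_2, and up to the contributions of F1 and
      F2 alone it is generated by the commutators [r1, y] and [x, r2].  The
      hypotheses on the Schur multipliers say that these depend only on the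
      images of r1, x, y, r2 in A = F1^ab and B = F2^ab.  If A' and B' are the
      images of R1 and R2, an element of K /\ S /\ gamma_3 is thus given by u in
      A' (x) B and v in A (x) B' having the same image in A (x) B.  As
      Tor(G^ab, H^ab) = 0 and A is free, both come from one element of A' (x) B'
      ([tensor_exact_square]), on which the two contributions cancel, being
      both given by [r1, r2] ([cartesian_degree2]).

    - c > 2: since G^ab (x) H^ab = 0, each [x, y] with x in F1 and y in F2 lies
      in S_1 gamma_3, and it follows that K is contained in (K /\ S) gamma_m for
      every m ([cartesian_cover]).  So for basis elements x and y we can choose
      c(x, y) in K /\ S congruent to [x, y] modulo gamma_(c+1).  Because F1 and
      F2 are free, these choices extend to an F-equivariant homomorphism sigma
      from K to (K /\ S)/S_c, congruent to the identity modulo gamma_(c+1)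
      ([deformation_exists]).  On the one hand sigma kills K /\ gamma_(c+1):
      this group lies in [K, _(c-1) F] ([cartesian_gamma]), which sigma maps
      into [S_1, _(c-1) F] = S_c.  On the other hand, for k in K /\ S the
      quotient of k by sigma(k) is in K /\ S /\ gamma_(c+1), hence in S_(c-1) by
      (I_(c-1)), hence is central modulo S_c; so sigma is the identity on
      [K /\ S, F].  Finally an element of K /\ S /\ gamma_(c+1) is in S_2 by
      (I_2), and K /\ S_2 is contained in [K /\ S, F] S_c ([cartesian_iter2]):
      modulo S_c it is both fixed and killed by sigma.

    An arbitrary free presentation of G * H is compared with F by lifting
    homomorphisms in both directions: two lifts of the same homomorphism agree
    on gamma_(c+1) modulo [R, _c F] ([lift_congr]). *)

(** * Homomorphisms, groups given by presentations, and quotients *)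

Section Homomorphisms.
Variables G H : groupType.

Definition hom_of (f : G -> H) (fM : {morph f : x y / x * y}) :
  {multiplicative G -> H} := HB.pack f (isMultiplicative.Build G H f fM).

Lemma trivial_homM : {morph (fun _ : G => 1 : H) : x y / x * y}.
Proof. by move=> x y; rewrite mulg1. Qed.

Variable f : {multiplicative G -> H}.

Lemma hom_mul x y : f (x * y) = f x * f y. Proof. exact: gmulfM. Qed.

Lemma hom_conj x y : f (x ^ y) = f x ^ f y.
Proof. by rewrite /conjg !gmulfM hom_inv. Qed.

Lemma hom_comm x y : f [~ x, y] = [~ f x, f y].
Proof. by rewrite /commg gmulfM hom_inv hom_conj. Qed.

End Homomorphisms.

Section Preimage.
Variables (G H : groupType) (f : {multiplicative G -> H}) (B : groupClosed H).

Definition hom_preim : {pred G} := fun x => f x \in B.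

Lemma hom_preim_mul : mulg_closed hom_preim.
Proof. by move=> x y Bx By; rewrite unfold_in gmulfM; exact: gpredM. Qed.
Lemma hom_preim_one : 1 \in hom_preim.
Proof. by rewrite unfold_in hom_one; exact: gpred1. Qed.
Lemma hom_preim_inv : invg_closed hom_preim.
Proof. by move=> x Bx; rewrite unfold_in hom_inv; exact: gpredVr. Qed.
HB.instance Definition _ := isMulClosed.Build G hom_preim hom_preim_mul.
HB.instance Definition _ := isMul1Closed.Build G hom_preim hom_preim_one.
HB.instance Definition _ := isInvClosed.Build G hom_preim hom_preim_inv.
End Preimage.

Section Equaliser.
Variables (G H : groupType) (f g : {multiplicative G -> H}).

Definition equaliser : {pred G} := fun x => f x == g x.

Lemma equaliser_mul : mulg_closed equaliser.
Proof. by move=> x y /eqP fx /eqP fy; rewrite unfold_in !gmulfM fx fy. Qed.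
Lemma equaliser_one : 1 \in equaliser.
Proof. by rewrite unfold_in !hom_one. Qed.
Lemma equaliser_inv : invg_closed equaliser.
Proof. by move=> x /eqP fx; rewrite unfold_in !hom_inv fx. Qed.
HB.instance Definition _ := isMulClosed.Build G equaliser equaliser_mul.
HB.instance Definition _ := isMul1Closed.Build G equaliser equaliser_one.
HB.instance Definition _ := isInvClosed.Build G equaliser equaliser_inv.
End Equaliser.

Section PresentedGroupLift.
Variables (A : choiceType) (i : A -> A) (r : seq A -> seq A -> Prop).
Variables (Q : groupType) (f : A -> Q).
Hypothesis fi : forall a, f (i a) = (f a)^-1.
Hypothesis fr : forall s t, r s t ->
  \prod_(a <- s) f a = \prod_(a <- t) f a.

Lemma word_cong_prod s t : word_cong i r s t ->
  \prod_(a <- s) f a = \prod_(a <- t) f a.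
Proof.
elim=> [u v w w' ww'|//|//|w w1 w2 _ -> _ -> //].
rewrite !big_cat /=; congr (_ * (_ * _)).
by case: ww' => [{}w {}w' /fr //|a|a];
  rewrite !big_cons !big_nil fi mulg1 ?mulgV ?mulVg.
Qed.

Lemma presented_group_lift :
  {g : {multiplicative presented_group i r -> Q} |
    forall s, g (of_word i r s) = \prod_(a <- s) f a}.
Proof.
pose g (x : presented_group i r) := \prod_(a <- repr x) f a.
have gE s : g (of_word i r s) = \prod_(a <- s) f a.
  exact/word_cong_prod/repr_of_word.
have gM : {morph g : x y / x * y}.
  move=> x y; rewrite -[RHS]big_cat -gE; congr g; exact: erefl.
by exists (hom_of gM).
Qed.

End PresentedGroupLift.

Lemma presented_group_mul (A : choiceType) (i : A -> A) r (s t : seq A) :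
  of_word i r s * of_word i r t = of_word i r (s ++ t).
Proof. exact: of_word_cat. Qed.

Section FreeGroup.
Variable X : choiceType.

Definition gen (x : X) : free_group X :=
  @of_word (bool * X)%type _ _ [:: (true, x)].

Lemma gen_inv x :
  @of_word (bool * X)%type (fun a => (~~ a.1, a.2)) (fun _ _ => False)
    [:: (false, x)] = (gen x)^-1.
Proof.
apply: (@mulgI (free_group X) (gen x)); rewrite mulgV [LHS]presented_group_mul.
by apply/of_wordP; exact: (WordStep [::] [::] (WordCancelR _ _ (true, x))).
Qed.

Lemma free_group_ind (P : free_group X -> Prop) :
  P 1 -> (forall x w, P w -> P (gen x * w)) ->
  (forall x w, P w -> P ((gen x)^-1 * w)) -> forall w, P w.
Proof.
move=> P1 Pg PV w; rewrite (of_wordE w); elim: (repr w) => [|[b x] s IHs].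
  exact: P1.
rewrite -cat1s -presented_group_mul; case: b; first exact: Pg.
by rewrite gen_inv; exact: PV.
Qed.

Lemma free_group_lift (Q : groupType) (f : X -> Q) :
  {g : {multiplicative free_group X -> Q} | forall x, g (gen x) = f x}.
Proof.
pose f' (a : bool * X) := if a.1 then f a.2 else (f a.2)^-1.
have [||g gE] := @presented_group_lift (bool * X)%type
  (fun a => (~~ a.1, a.2)) (fun _ _ => False) Q f'.
- by case=> [[] x] //=; rewrite /f' /= invgK.
- by [].
by exists g => x; rewrite gE big_seq1.
Qed.

Lemma free_group_gen (A : groupClosed (free_group X)) :
  (forall x, gen x \in A) -> forall w, w \in A.
Proof.
move=> Agen; apply: free_group_ind => [|x w Aw|x w Aw]; first exact: gpred1.
  exact: gpredM.
by apply: gpredM => //; exact: gpredVr.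
Qed.

Lemma free_group_hom_ext (Q : groupType) (f g : {multiplicative free_group X -> Q}) :
  (forall x, f (gen x) = g (gen x)) -> f =1 g.
Proof.
move=> fg w; apply/eqP; apply: (@free_group_gen (equaliser f g)) => x.
by apply/eqP.
Qed.

End FreeGroup.

Lemma free_group_projective (X : choiceType) (E G : groupType)
    (p : {multiplicative free_group X -> G}) (f : {multiplicative E -> G}) :
  (forall g, exists x, f x = g) ->
  {h : {multiplicative free_group X -> E} | forall w, f (h w) = p w}.
Proof.
move=> f_surj.
have [h hE] := free_group_lift (fun x => projT1 (cid (f_surj (p (gen x))))).
exists h; apply: (@free_group_hom_ext _ _ (f \o h)) => x.
by rewrite /= hE; case: cid.
Qed.

Section FreeProduct.
Variables G H : groupType.

Local Notation letter_inv :=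
  (fun a : G + H => match a with inl x => inl x^-1 | inr y => inr y^-1 end).

Definition fp_of (s : seq (G + H)) : free_product G H :=
  @of_word (G + H)%type letter_inv (@free_product_rel G H) s.

Lemma fp_of_mul s t : fp_of s * fp_of t = fp_of (s ++ t).
Proof. exact: presented_group_mul. Qed.

Lemma fp_of_rel s t : free_product_rel s t -> fp_of s = fp_of t.
Proof.
move=> st; apply/of_wordP; rewrite -(cats0 s) -(cats0 t).
exact: (WordStep [::] [::] (WordRel _ st)).
Qed.

(** The two injections are opaque, so that simplification keeps them folded. *)
Lemma fp_inl_exists :
  {f : {multiplicative G -> free_product G H} | forall x, f x = fp_of [:: inl x]}.
Proof.
have fM : {morph (fun x : G => fp_of [:: inl x]) : x y / x * y}.
  by move=> x y; rewrite fp_of_mul; apply/esym/fp_of_rel/FPmulL.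
by exists (hom_of fM).
Qed.

Lemma fp_inr_exists :
  {f : {multiplicative H -> free_product G H} | forall y, f y = fp_of [:: inr y]}.
Proof.
have fM : {morph (fun y : H => fp_of [:: inr y]) : x y / x * y}.
  by move=> x y; rewrite fp_of_mul; apply/esym/fp_of_rel/FPmulR.
by exists (hom_of fM).
Qed.

Definition fp_inl : {multiplicative G -> free_product G H} := sval fp_inl_exists.
Definition fp_inr : {multiplicative H -> free_product G H} := sval fp_inr_exists.

Lemma fp_inlE x : fp_inl x = fp_of [:: inl x]. Proof. exact: (svalP fp_inl_exists). Qed.
Lemma fp_inrE y : fp_inr y = fp_of [:: inr y]. Proof. exact: (svalP fp_inr_exists). Qed.

Lemma free_product_ind (P : free_product G H -> Prop) :
  P 1 -> (forall x w, P w -> P (fp_inl x * w)) ->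
  (forall y w, P w -> P (fp_inr y * w)) -> forall w, P w.
Proof.
move=> P1 PG PH w; rewrite (of_wordE w); elim: (repr w) => [|[x|y] s IHs].
- exact: P1.
- by rewrite -cat1s -presented_group_mul -/(fp_of _) -fp_inlE; exact: PG.
- by rewrite -cat1s -presented_group_mul -/(fp_of _) -fp_inrE; exact: PH.
Qed.

Lemma free_product_lift (Q : groupType) (f : {multiplicative G -> Q})
    (g : {multiplicative H -> Q}) :
  {h : {multiplicative free_product G H -> Q} |
    (forall x, h (fp_inl x) = f x) /\ (forall y, h (fp_inr y) = g y)}.
Proof.
pose k (a : G + H) := match a with inl x => f x | inr y => g y end.
have [||h hE] := @presented_group_lift (G + H)%type letter_inv
    (@free_product_rel G H) Q k.
- by case=> x; rewrite /k hom_inv.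
- move=> _ _ [||x y|x y]; rewrite ?big_nil ?big_seq1 ?big_cons ?big_nil /k;
    by rewrite ?hom_one ?mulg1 ?gmulfM.
by exists h; split=> x; rewrite (fp_inlE, fp_inrE) hE big_seq1.
Qed.

Lemma free_product_gen (A : groupClosed (free_product G H)) :
  (forall x, fp_inl x \in A) -> (forall y, fp_inr y \in A) -> forall w, w \in A.
Proof.
move=> AG AH; apply: free_product_ind => [|x w Aw|x w Aw]; first exact: gpred1.
  by apply: gpredM.
by apply: gpredM.
Qed.

Lemma free_product_hom_ext (Q : groupType)
    (f g : {multiplicative free_product G H -> Q}) :
  (forall x, f (fp_inl x) = g (fp_inl x)) ->
  (forall y, f (fp_inr y) = g (fp_inr y)) -> f =1 g.
Proof.
move=> fgG fgH w; apply/eqP.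
by apply: (@free_product_gen (equaliser f g)) => x; apply/eqP.
Qed.

End FreeProduct.

Section QuotientGroup.
Variables (F : groupType) (N : groupClosed F).

Section Build.
Hypothesis nN : is_normal N.

Definition lcoset_rel (_ : is_normal N) : rel F := fun x y => x^-1 * y \in N.
Local Notation equiv := (lcoset_rel nN).

Lemma lcoset_class : equiv_class_of equiv.
Proof.
split=> [x|x y|y x z]; rewrite /lcoset_rel.
- by rewrite mulVg gpred1.
- by rewrite -gpredV invgM invgK.
- by move=> Nxy Nyz; rewrite -(mulgK y x^-1) -mulgA gpredM.
Qed.

Canonical lcoset_equiv := EquivRelPack lcoset_class.
Canonical lcoset_encModRel := defaultEncModRel equiv.

Definition quotient_group := {eq_quot equiv}.
HB.instance Definition _ : EqQuotient F equiv quotient_group :=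
  EqQuotient.on quotient_group.
HB.instance Definition _ := Choice.on quotient_group.

Definition qcoset (x : F) : quotient_group := \pi_quotient_group x.

Lemma qcosetP x y : qcoset x = qcoset y <-> x^-1 * y \in N.
Proof. by split=> [/eqmodP|Nxy]; last exact/eqmodP. Qed.

Lemma qcosetK x : qcoset (repr x) = x. Proof. exact: reprK. Qed.

Definition qmul (x y : quotient_group) := qcoset (repr x * repr y).
Definition qinv (x : quotient_group) := qcoset (repr x)^-1.

Lemma qmulE x y : qmul (qcoset x) (qcoset y) = qcoset (x * y).
Proof.
have /qcosetP Nx := qcosetK (qcoset x); have /qcosetP Ny := qcosetK (qcoset y).
apply/qcosetP; move: Nx Ny; set x' := repr (qcoset x); set y' := repr (qcoset y).
move=> Nx Ny.
suff -> : (x' * y')^-1 * (x * y) = (x'^-1 * x) ^ y' * (y'^-1 * y).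
  by apply: gpredM => //; exact: nN.
by rewrite /conjg invgM !mulgA mulgK.
Qed.

Lemma qmulA : associative qmul.
Proof.
by move=> x y z; rewrite -(qcosetK x) -(qcosetK y) -(qcosetK z) !qmulE mulgA.
Qed.
Lemma qmul1 : left_id (qcoset 1) qmul.
Proof. by move=> x; rewrite -(qcosetK x) qmulE mul1g. Qed.
Lemma q1mul : right_id (qcoset 1) qmul.
Proof. by move=> x; rewrite -(qcosetK x) qmulE mulg1. Qed.
Lemma qmulV : left_inverse (qcoset 1) qinv qmul.
Proof. by move=> x; rewrite -{2}(qcosetK x) qmulE mulVg. Qed.
Lemma qmulgV : right_inverse (qcoset 1) qinv qmul.
Proof. by move=> x; rewrite -{1}(qcosetK x) qmulE mulgV. Qed.

HB.instance Definition _ :=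
  isGroup.Build quotient_group qmulA qmul1 q1mul qmulV qmulgV.

End Build.

(** The quotient is packaged existentially: all that matters of F / N below is
    the projection and its kernel. *)
Lemma quotient_exists : is_normal N ->
  exists (Q : groupType) (q : {multiplicative F -> Q}),
    (forall x, q x = 1 <-> x \in N) /\ (forall y, exists x, q x = y).
Proof.
move=> nN; have qM : {morph qcoset nN : x y / x * y}.
  by move=> x y; rewrite -qmulE.
exists (quotient_group nN : groupType), (hom_of qM); split=> [x|y]; last first.
  by exists (repr y); exact: qcosetK.
rewrite -[1](hom_one (hom_of qM)); split=> [/qcosetP|Nx].
  by rewrite mulg1 gpredV.
by apply/qcosetP; rewrite mulg1 gpredV.
Qed.

End QuotientGroup.

Lemma hom_factor (E G Q : groupType) (p : {multiplicative E -> G})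
    (f : {multiplicative E -> Q}) :
  (forall g, exists x, p x = g) -> (forall x, p x = 1 -> f x = 1) ->
  {h : {multiplicative G -> Q} | forall x, h (p x) = f x}.
Proof.
move=> p_surj kf; pose s g := projT1 (cid (p_surj g)).
have sK g : p (s g) = g by rewrite /s; case: cid.
have fE x y : p x = p y -> f x = f y.
  move=> pxy; apply: (@mulIg _ (f y)^-1); rewrite mulgV -hom_inv -gmulfM.
  by apply: kf; rewrite gmulfM hom_inv pxy mulgV.
have hM : {morph (fun g => f (s g)) : x y / x * y}.
  by move=> x y; rewrite -gmulfM; apply: fE; rewrite gmulfM !sK.
by exists (hom_of hM) => x; apply: fE; rewrite sK.
Qed.

(** * Commutators and normal subgroups *)

Section CommutatorIdentities.
Variable G : groupType.
Implicit Types x y z : G.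

Lemma comm_mulr x y z : [~ x, y * z] = [~ x, z] * [~ x, y] ^ z.
Proof. by rewrite /commg /conjg !gnorm. Qed.

Lemma comm_mull x y z : [~ x * y, z] = [~ x, z] ^ y * [~ y, z].
Proof. by rewrite /commg /conjg !gnorm. Qed.

Lemma comm_eq1 x y : [~ x, y] = 1 <-> commute x y.
Proof. by split=> [/eqP/commgP|/commgP/eqP]. Qed.

Lemma commute_conj x y : commute x y -> x ^ y = x.
Proof. by move=> xy; apply/conjg_fixP/eqP/comm_eq1. Qed.

Lemma comm_mulr_central x y z :
  commute [~ x, y] z -> [~ x, y * z] = [~ x, z] * [~ x, y].
Proof. by move=> xyz; rewrite comm_mulr (commute_conj xyz). Qed.

Lemma comm_mull_central x y z :
  commute [~ x, z] y -> [~ x * y, z] = [~ x, z] * [~ y, z].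
Proof. by move=> xyz; rewrite comm_mull (commute_conj xyz). Qed.

Definition central z := forall x, commute z x.

Lemma central1 : central 1. Proof. by move=> x; apply/commute_sym/commute1. Qed.
Lemma centralM x y : central x -> central y -> central (x * y).
Proof. by move=> cx cy z; apply/commute_sym/commuteM; apply/commute_sym. Qed.
Lemma centralV x : central x -> central x^-1.
Proof. by move=> cx z; apply/commute_sym/commuteV/commute_sym. Qed.

Definition center : {pred G} := fun z => `[< central z >].
Lemma center_mul : mulg_closed center.
Proof. by move=> x y /asboolP cx /asboolP cy; apply/asboolP/centralM. Qed.
Lemma center_one : 1 \in center. Proof. exact/asboolP/central1. Qed.
Lemma center_inv : invg_closed center.
Proof. by move=> x /asboolP cx; apply/asboolP/centralV. Qed.
HB.instance Definition _ := isMulClosed.Build G center center_mul.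
HB.instance Definition _ := isMul1Closed.Build G center center_one.
HB.instance Definition _ := isInvClosed.Build G center center_inv.

(** When all commutators of a and b are central, the bracket expands as if it
    were bilinear, and k contributes nothing. *)
Lemma comm_expand (a b X Y k : G) :
  (forall z, central [~ a, z]) -> (forall z, central [~ b, z]) ->
  commute a k -> commute b k ->
  [~ a * b, X * Y * k] = [~ a, X] * [~ b, Y] * ([~ a, Y] * [~ X, b]^-1).
Proof.
move=> ca cb ak bk.
have abE z : [~ a * b, z] = [~ a, z] * [~ b, z].
  by rewrite comm_mull_central //; exact: ca.
have c_ab z : central [~ a * b, z] by rewrite abE; apply: centralM.
rewrite comm_mulr_central; last exact: c_ab.
have /comm_eq1 -> : commute (a * b) k.
  by apply: commute_sym; apply: commuteM; apply: commute_sym.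
rewrite mul1g comm_mulr_central; last exact: c_ab.
rewrite !abE invgR mulgA -(ca X) (ca Y [~ b, Y]).
by rewrite !mulgA.
Qed.

Section Centraliser.
Variable A : G -> Prop.
Definition centraliser : {pred G} := fun z => `[< forall x, A x -> commute x z >].
Lemma centraliserP z :
  reflect (forall x, A x -> commute x z) (z \in centraliser).
Proof. exact: asboolP. Qed.
Lemma centraliser_mul : mulg_closed centraliser.
Proof.
move=> x y /centraliserP cx /centraliserP cy; apply/centraliserP => z Az.
by apply: commuteM; [exact: cx|exact: cy].
Qed.
Lemma centraliser_one : 1 \in centraliser.
Proof. by apply/centraliserP => z _; exact: commute1. Qed.
Lemma centraliser_inv : invg_closed centraliser.
Proof.
by move=> x /centraliserP cx; apply/centraliserP => z Az; exact/commuteV/cx.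
Qed.
HB.instance Definition _ := isMulClosed.Build G centraliser centraliser_mul.
HB.instance Definition _ := isMul1Closed.Build G centraliser centraliser_one.
HB.instance Definition _ := isInvClosed.Build G centraliser centraliser_inv.
End Centraliser.

End CommutatorIdentities.

Section NormalSubgroups.
Variable F : groupType.
Implicit Types A B N : groupClosed F.

Lemma normal_comml N x y : is_normal N -> x \in N -> [~ x, y] \in N.
Proof. by move=> nN Nx; rewrite commgEl gpredM ?gpredV //; exact: nN. Qed.

Lemma normal_swap N x y : is_normal N -> x * y \in N -> y * x \in N.
Proof. by move=> nN Nxy; rewrite (conjgC y x) mulgA; have := nN _ x Nxy; rewrite /conjg !gnorm. Qed.

Section Product.
Variables A B : groupClosed F.
Definition subgroup_prod (_ : is_normal B) : {pred F} :=
  fun z => `[< exists x y, [/\ x \in A, y \in B & z = x * y] >].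
Hypothesis nB : is_normal B.

Lemma subgroup_prodP z :
  reflect (exists x y, [/\ x \in A, y \in B & z = x * y])
          (z \in subgroup_prod nB).
Proof. exact: asboolP. Qed.

Lemma subgroup_prod_mul : mulg_closed (subgroup_prod nB).
Proof.
move=> _ _ /subgroup_prodP[x [y [Ax By ->]]] /subgroup_prodP[x' [y' [Ax' By' ->]]].
apply/subgroup_prodP; exists (x * x'), (y ^ x' * y'); split.
- exact: gpredM.
- by apply: gpredM => //; exact: nB.
- by rewrite /conjg !gnorm.
Qed.
Lemma subgroup_prod_one : 1 \in subgroup_prod nB.
Proof.
by apply/subgroup_prodP; exists 1, 1; rewrite !gpred1 mulg1.
Qed.
Lemma subgroup_prod_inv : invg_closed (subgroup_prod nB).
Proof.
move=> _ /subgroup_prodP[x [y [Ax By ->]]].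
apply/subgroup_prodP; exists x^-1, (y^-1 ^ x^-1); split.
- exact: gpredVr.
- by apply/nB/gpredVr.
- by rewrite /conjg !gnorm.
Qed.
HB.instance Definition _ := isMulClosed.Build F (subgroup_prod nB) subgroup_prod_mul.
HB.instance Definition _ := isMul1Closed.Build F (subgroup_prod nB) subgroup_prod_one.
HB.instance Definition _ := isInvClosed.Build F (subgroup_prod nB) subgroup_prod_inv.

Lemma subgroup_prod_normal : is_normal A -> is_normal (subgroup_prod nB).
Proof.
move=> nA z w /subgroup_prodP[x [y [Ax By ->]]]; apply/subgroup_prodP.
by exists (x ^ w), (y ^ w); rewrite conjMg; split=> //; [exact: nA|exact: nB].
Qed.

Lemma subgroup_prodl x : x \in A -> x \in subgroup_prod nB.
Proof. by move=> Ax; apply/subgroup_prodP; exists x, 1; rewrite gpred1 mulg1. Qed.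
Lemma subgroup_prodr x : x \in B -> x \in subgroup_prod nB.
Proof. by move=> Bx; apply/subgroup_prodP; exists 1, x; rewrite gpred1 mul1g. Qed.
End Product.

Lemma subgroupI_normal A B : is_normal A -> is_normal B -> is_normal (subgroupI A B).
Proof. by move=> nA nB x y /andP[/nA Ax /nB Bx]; apply/andP. Qed.

Lemma gamma_normal n : is_normal (gamma F n).
Proof. exact/iter_commutator_normal/whole_normal. Qed.

Lemma iter_commutator_min A N n :
  (forall x y, x \in iter_commutator A n -> [~ x, y] \in N) ->
  forall z, z \in iter_commutator A n.+1 -> z \in N.
Proof. by move=> AN; apply: commutator_min => x y Ax _; exact: AN. Qed.

Lemma gamma_min N n :
  (forall x y, x \in gamma F n.+1 -> [~ x, y] \in N) ->
  forall z, z \in gamma F n.+2 -> z \in N.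
Proof. exact: iter_commutator_min. Qed.

Lemma mem_iter_commutatorS A n x y :
  x \in iter_commutator A n -> [~ x, y] \in iter_commutator A n.+1.
Proof. by move=> Ax; exact: mem_commutator. Qed.

Lemma mem_gammaS n x y : x \in gamma F n.+1 -> [~ x, y] \in gamma F n.+2.
Proof. exact: mem_iter_commutatorS. Qed.

Lemma iter_commutator_sub_le A m n : is_normal A -> m <= n ->
  forall x, x \in iter_commutator A n -> x \in iter_commutator A m.
Proof.
move=> nA /subnK <-; elim: (n - m) => [|k IHk] x //.
by rewrite addSn => /(iter_commutator_sub nA)/IHk.
Qed.

Lemma gamma_sub_le m n : m <= n -> forall x, x \in gamma F n -> x \in gamma F m.
Proof.
move=> mn; apply: iter_commutator_sub_le; first exact: whole_normal.
by rewrite -!subn1 leq_sub2r.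
Qed.

End NormalSubgroups.

Section HomImages.
Variables E F : groupType.

Lemma hom_commutator (f : {multiplicative E -> F}) (A A' : groupClosed E)
    (B B' : groupClosed F) :
  (forall x, x \in A -> f x \in B) -> (forall x, x \in A' -> f x \in B') ->
  forall x, x \in commutator A A' -> f x \in commutator B B'.
Proof.
move=> fA fA'; apply: (commutator_min (N := hom_preim f (commutator B B'))).
move=> x y Ax Ay; rewrite unfold_in hom_comm.
by apply: mem_commutator; [exact: fA|exact: fA'].
Qed.

Lemma hom_iter_commutator (f : {multiplicative E -> F}) (A : groupClosed E)
    (B : groupClosed F) n :
  (forall x, x \in A -> f x \in B) ->
  forall x, x \in iter_commutator A n -> f x \in iter_commutator B n.
Proof. by move=> fA; elim: n => //= n IHn; exact: hom_commutator. Qed.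

Lemma hom_gamma (f : {multiplicative E -> F}) n x :
  x \in gamma E n -> f x \in gamma F n.
Proof. exact: hom_iter_commutator. Qed.

(** Lifts of one homomorphism through a presentation with relators R differ by
    elements of R, and the difference is invisible in the multiplier.  In the
    inductive step the error r made on u is central modulo [R, _(n+1) F], and
    the error s made on v commutes there with gamma_(n+1)(F), so that
    [u r, v s] = [u, v]. *)
Lemma lift_congr (f g : {multiplicative E -> F}) (R : groupClosed F) :
  is_normal R -> (forall x, (f x)^-1 * g x \in R) ->
  forall n w, w \in gamma E n.+1 -> (f w)^-1 * g w \in iter_commutator R n.
Proof.
move=> nR fg; elim=> [|n IHn] //.
have [Q [q [qK _]]] := quotient_exists (iter_commutator_normal (c := n.+1) nR).
have qE x y : x^-1 * y \in iter_commutator R n.+1 <-> q x = q y.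
  rewrite -qK gmulfM hom_inv; split=> [/mulg1_eq|->]; last exact: mulVg.
  by rewrite invgK.
suff fgq w : w \in gamma E n.+2 -> w \in equaliser (q \o f) (q \o g).
  by move=> w /fgq /eqP; rewrite qE.
move: w; apply: gamma_min => u v gu; apply/eqP.
rewrite /= !(hom_comm f) !(hom_comm g).
have Rr : (f u)^-1 * g u \in iter_commutator R n by exact: IHn.
have Rs : (f v)^-1 * g v \in R by [].
rewrite -(mulVKg (f u) (g u)) -(mulVKg (f v) (g v)).
move: Rr Rs; set r := (f u)^-1 * _; set s := (f v)^-1 * _ => Rr Rs; clearbody r s.
have cr x : commute (q r) (q x).
  by apply/comm_eq1; rewrite -hom_comm; apply/qK/mem_iter_commutatorS.
have cs x : x \in gamma F n.+1 -> commute (q s) (q x).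
  move=> gx; apply/comm_eq1; rewrite -hom_comm; apply/qK.
  exact: (iter_commutator_gamma (j := 0) (k := n)).
have gfu := hom_gamma f gu.
rewrite !hom_comm !gmulfM comm_mull.
have /comm_eq1 -> : commute (q r) (q (f v) * q s) by rewrite -gmulfM.
rewrite mulg1 (commute_conj (commute_sym _)); last first.
  by rewrite -gmulfM -hom_comm; exact: cr.
rewrite comm_mulr; have /comm_eq1 -> := commute_sym (cs _ gfu).
rewrite mul1g (commute_conj _) // -hom_comm.
apply/commute_sym/cs; apply: normal_comml gfu; exact: gamma_normal.
Qed.

End HomImages.

(** * The cartesian subgroup of a free product *)

Lemma quotient_eq (F Q : groupType) (N : groupClosed F) (q : {multiplicative F -> Q}) :
  (forall x, q x = 1 <-> x \in N) ->
  forall x y, q x = q y <-> x^-1 * y \in N.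
Proof.
move=> qN x y; rewrite -qN gmulfM hom_inv; split=> [->|/mulg1_eq].
  exact: mulVg.
by rewrite invgK.
Qed.

Lemma quotient_commute (F Q : groupType) (N : groupClosed F)
    (q : {multiplicative F -> Q}) :
  (forall x, q x = 1 <-> x \in N) ->
  forall x y, commute (q x) (q y) <-> [~ x, y] \in N.
Proof. by move=> qN x y; rewrite -qN hom_comm comm_eq1. Qed.

Lemma quotient_central (F Q : groupType) (N : groupClosed F)
    (q : {multiplicative F -> Q}) :
  (forall x, q x = 1 <-> x \in N) -> (forall y, exists x, q x = y) ->
  forall x, (forall y, [~ x, y] \in N) -> central (q x).
Proof.
move=> qN q_surj x Nx z; have [y <-] := q_surj z.
exact/(quotient_commute qN).
Qed.

Section DerivedCommutes.
Variables (E1 E2 Q : groupType).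
Variables (a : {multiplicative E1 -> Q}) (b : {multiplicative E2 -> Q}).

(** Conjugation by b y multiplies a r by a central element and a x by an
    element that commutes with a T; neither change affects [a r, a x]. *)
Lemma derived_commutes (T : groupClosed E1) : is_normal T ->
  (forall r y, r \in T -> central [~ a r, b y]) ->
  (forall x y r, r \in T -> commute [~ a x, b y] (a r)) ->
  forall t y, t \in commutator T (whole E1) -> commute (a t) (b y).
Proof.
move=> nT cT kT t y Tt; apply: commute_sym.
have: t \in hom_preim a (centraliser (fun z => exists y, z = b y)); last first.
  by move=> /centraliserP; apply; exists y.
move: t Tt {y}; apply: commutator_min => r x Tr _.
apply/centraliserP => _ [y ->]; apply/commute_sym/comm_eq1/eqP.
rewrite -conjg_fix; apply/eqP; rewrite hom_comm conjRg.
have conjE u : a u ^ b y = a u * [~ a u, b y] by rewrite /commg mulVKg.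
rewrite !conjE; have := cT r y Tr; have := kT x y; have := kT x y _ Tr.
move: [~ a x, b y] [~ a r, b y] => k c kr kT' cc; rewrite comm_mull.
have /comm_eq1 -> := cc (a x * k); rewrite mulg1.
rewrite (commute_conj (commute_sym (cc _))) comm_mulr.
have /comm_eq1 -> := commute_sym kr; rewrite mul1g -hom_comm commute_conj //.
exact/commute_sym/kT'/normal_comml.
Qed.

End DerivedCommutes.

Section Cartesian.
Variables F1 F2 : groupType.

Local Notation F := (free_product F1 F2).
Local Notation i1 := (fp_inl F1 F2).
Local Notation i2 := (fp_inr F1 F2).

Definition fp_prl : {multiplicative F -> F1} :=
  sval (free_product_lift (idfun : {multiplicative F1 -> F1})
                          (hom_of (@trivial_homM F2 F1))).
Definition fp_prr : {multiplicative F -> F2} :=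
  sval (free_product_lift (hom_of (@trivial_homM F1 F2))
                          (idfun : {multiplicative F2 -> F2})).
Local Notation p1 := fp_prl.
Local Notation p2 := fp_prr.

Lemma fp_prl_inl x : p1 (i1 x) = x.
Proof. by rewrite /fp_prl; case: free_product_lift => h [] /= ->. Qed.
Lemma fp_prl_inr y : p1 (i2 y) = 1.
Proof. by rewrite /fp_prl; case: free_product_lift => h [] /= _ ->. Qed.
Lemma fp_prr_inl x : p2 (i1 x) = 1.
Proof. by rewrite /fp_prr; case: free_product_lift => h [] /= ->. Qed.
Lemma fp_prr_inr y : p2 (i2 y) = y.
Proof. by rewrite /fp_prr; case: free_product_lift => h [] /= _ ->. Qed.

Definition fp_prE := (fp_prl_inl, fp_prl_inr, fp_prr_inl, fp_prr_inr).

(** A lift to F of the image of f in F1 x F2. *)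
Definition split_part (f : F) : F := i1 (p1 f) * i2 (p2 f).

(** The kernel of the homomorphism from the free product to F1 x F2. *)
Definition cartesian : groupClosed F := subgroupI (kernel p1) (kernel p2).

Lemma cartesianP f : f \in cartesian <-> p1 f = 1 /\ p2 f = 1.
Proof. by split=> [/andP[/eqP ? /eqP]|[/eqP ? /eqP ?]] //; apply/andP. Qed.

Lemma cartesian_normal : is_normal cartesian.
Proof. by apply: subgroupI_normal => x y; apply: kernel_conj. Qed.

Lemma comm_cartesian x y : [~ i1 x, i2 y] \in cartesian.
Proof.
by apply/cartesianP; rewrite !hom_comm !fp_prE comm1g commg1.
Qed.

Lemma split_part_cartesian f : f \in cartesian -> split_part f = 1.
Proof. by case/cartesianP=> f1 f2; rewrite /split_part f1 f2 !hom_one mulg1. Qed.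

Lemma split_cartesian f : (split_part f)^-1 * f \in cartesian.
Proof.
by apply/cartesianP; rewrite !gmulfM !hom_inv !gmulfM !fp_prE mulg1 mul1g !mulVg.
Qed.

Lemma split_hom (Q : groupType) (q : {multiplicative F -> Q}) :
  (forall x y, commute (q (i1 x)) (q (i2 y))) ->
  forall f, q f = q (split_part f).
Proof.
move=> q12; rewrite /split_part.
apply: free_product_ind => [|x w IHw|y w IHw].
- by rewrite !hom_one mulg1 hom_one.
- by rewrite !gmulfM !fp_prE !hom_one mul1g IHw !gmulfM mulgA.
- by rewrite !gmulfM !fp_prE !hom_one mul1g IHw !gmulfM !mulgA -(q12 _ y).
Qed.

(** Modulo N the two factors commute, so every element equals its split part,
    which is trivial for an element of the cartesian subgroup. *)
Lemma cartesian_min (N : groupClosed F) : is_normal N ->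
  (forall x y, [~ i1 x, i2 y] \in N) -> forall f, f \in cartesian -> f \in N.
Proof.
move=> nN cN f Kf; have [Q [q [qN _]]] := quotient_exists nN.
apply/qN; rewrite (split_hom (q := q)) ?split_part_cartesian ?hom_one //.
by move=> x y; apply/(quotient_commute qN).
Qed.

Section SplitCommutators.
Variables (Q : groupType) (q : {multiplicative F -> Q}).
Variables (T1 : groupClosed F1) (T2 : groupClosed F2).
Hypotheses (nT1 : is_normal T1) (nT2 : is_normal T2).
Hypothesis qT1 : forall t y, t \in T1 -> commute (q (i1 t)) (q (i2 y)).
Hypothesis qT2 : forall t x, t \in T2 -> commute (q (i2 t)) (q (i1 x)).

(** Elements of the other factor centralise T1, so F acts on T1 through F1. *)
Lemma conj_split_l f t : t \in T1 -> q (i1 t) ^ q f = q (i1 (t ^ p1 f)).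
Proof.
move: f t; apply: free_product_ind => [|x w IHw|y w IHw] t Tt.
- by rewrite !hom_one !conjg1.
- rewrite (hom_mul q) (hom_mul p1) fp_prE !conjgM -(hom_conj q) -(hom_conj i1).
  by rewrite IHw ?nT1.
- by rewrite (hom_mul q) (hom_mul p1) fp_prE mul1g conjgM (commute_conj (qT1 _ _)) ?IHw.
Qed.

Lemma conj_split_r f t : t \in T2 -> q (i2 t) ^ q f = q (i2 (t ^ p2 f)).
Proof.
move: f t; apply: free_product_ind => [|x w IHw|y w IHw] t Tt.
- by rewrite !hom_one !conjg1.
- by rewrite (hom_mul q) (hom_mul p2) fp_prE mul1g conjgM (commute_conj (qT2 _ _)) ?IHw.
- rewrite (hom_mul q) (hom_mul p2) fp_prE !conjgM -(hom_conj q) -(hom_conj i2).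
  by rewrite IHw ?nT2.
Qed.

(** The elements that q does not distinguish from their split part; T1 and T2
    ensure that they form a subgroup. *)
Definition split_mod : {pred F} :=
  fun f => [&& p1 f \in T1, p2 f \in T2 & q f == q (split_part f)].

Lemma split_mod_mul : mulg_closed split_mod.
Proof.
move=> x y /and3P[x1 x2 /eqP xE] /and3P[y1 y2 /eqP yE].
apply/and3P; split; rewrite ?gmulfM ?gpredM // xE yE /split_part !gmulfM.
by rewrite !mulgA -(mulgA _ (q (i2 _)) (q (i1 _))) (qT2 _ x2) !mulgA.
Qed.
Lemma split_mod_one : 1 \in split_mod.
Proof.
by apply/and3P; rewrite /split_part !hom_one !gpred1 mulg1 hom_one.
Qed.
Lemma split_mod_inv : invg_closed split_mod.
Proof.
move=> x /and3P[x1 x2 /eqP xE]; apply/and3P.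
split; rewrite ?hom_inv ?gpredV // xE /split_part !hom_inv !gmulfM !hom_inv.
by rewrite invgM; apply/eqP/commuteV/commute_sym/commuteV/qT1.
Qed.
Definition split_mod_group : groupClosed F :=
  HB.pack split_mod (isMulClosed.Build _ _ split_mod_mul)
    (isMul1Closed.Build _ _ split_mod_one) (isInvClosed.Build _ _ split_mod_inv).

(** A central error is lost in a commutator, and f acts on the two projections
    of s separately by [conj_split_l] and [conj_split_r]. *)
Lemma split_mod_comm s f : p1 s \in T1 -> p2 s \in T2 ->
  central (q ((split_part s)^-1 * s)) -> [~ s, f] \in split_mod_group.
Proof.
move=> s1 s2; set v := _ * s => cv; apply/and3P; split.
- by rewrite hom_comm; exact: normal_comml.
- by rewrite hom_comm; exact: normal_comml.
have qs : q s = q (i1 (p1 s)) * q (i2 (p2 s)) * q v.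
  by rewrite -(hom_mul q) -(hom_mul q) /v mulVKg.
rewrite hom_comm qs comm_mull; have /comm_eq1 -> := cv (q f).
rewrite mulg1 (commute_conj (commute_sym (cv _))) /split_part.
rewrite (hom_comm p1) (hom_comm p2).
move: (p1 s) (p2 s) s1 s2 => t1 t2 Tt1 Tt2.
rewrite !(hom_mul q) commgEl conjMg conj_split_l // conj_split_r // invgM.
have -> : q (i1 (t1 ^ p1 f)) = q (i1 t1) * q (i1 [~ t1, p1 f]).
  by rewrite -(hom_mul q) -(hom_mul i1) /commg mulVKg.
have -> : q (i2 (t2 ^ p2 f)) = q (i2 t2) * q (i2 [~ t2, p2 f]).
  by rewrite -(hom_mul q) -(hom_mul i2) /commg mulVKg.
have c12 : commute (q (i1 [~ t1, p1 f])) (q (i2 t2)).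
  by apply: qT1; exact: normal_comml.
by rewrite -!mulgA mulKg (mulgA _ (q (i2 t2))) c12 -mulgA mulKg.
Qed.

End SplitCommutators.

End Cartesian.

(** * The cartesian subgroup and the lower central series *)

Section CartesianGamma.
Variables F1 F2 : groupType.

Local Notation F := (free_product F1 F2).
Local Notation i1 := (fp_inl F1 F2).
Local Notation i2 := (fp_inr F1 F2).
Local Notation p1 := (fp_prl F1 F2).
Local Notation p2 := (fp_prr F1 F2).
Local Notation K := (cartesian F1 F2).

(** By [derived_commutes] modulo [K, _n F]: an element [x, y] of K centralises
    gamma_n(F1) there, because [K, gamma_n(F)] is contained in [K, _n F]. *)
Lemma comm_gamma_l n g y :
  g \in gamma F1 n.+1 -> [~ i1 g, i2 y] \in iter_commutator K n.
Proof.
elim: n g y => [|n IHn] g y gg; first exact: comm_cartesian.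
have nKn := iter_commutator_normal (c := n.+1) (@cartesian_normal F1 F2).
have [Q [q [qK q_surj]]] := quotient_exists nKn; apply/(quotient_commute qK).
apply: (@derived_commutes _ _ _ (q \o i1) (q \o i2) (gamma F1 n.+1)) => //=.
- exact: gamma_normal.
- move=> {gg}g' {}y gg; rewrite -hom_comm.
  by apply: (quotient_central qK) => // z; apply/mem_iter_commutatorS/IHn.
- move=> x {}y r gr; rewrite -hom_comm; apply/(quotient_commute qK).
  apply: (iter_commutator_gamma (j := 0) (k := n) (@cartesian_normal F1 F2)).
    exact: comm_cartesian.
  exact: (hom_gamma _ gr).
Qed.

Lemma comm_gamma_r n g x :
  g \in gamma F2 n.+1 -> [~ i2 g, i1 x] \in iter_commutator K n.
Proof.
elim: n g x => [|n IHn] g x gg.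
  by rewrite -invgR gpredV; exact: comm_cartesian.
have nKn := iter_commutator_normal (c := n.+1) (@cartesian_normal F1 F2).
have [Q [q [qK q_surj]]] := quotient_exists nKn; apply/(quotient_commute qK).
apply: (@derived_commutes _ _ _ (q \o i2) (q \o i1) (gamma F2 n.+1)) => //=.
- exact: gamma_normal.
- move=> {gg}g' {}x gg; rewrite -hom_comm.
  by apply: (quotient_central qK) => // z; apply/mem_iter_commutatorS/IHn.
- move=> {}x y r gr; rewrite -hom_comm; apply/(quotient_commute qK).
  apply: (iter_commutator_gamma (j := 0) (k := n) (@cartesian_normal F1 F2)).
    by rewrite -invgR gpredV; exact: comm_cartesian.
  exact: (hom_gamma _ gr).
Qed.

(** Passing from n to n+1 is [split_mod_comm] with T1 and T2 the terms of the
    lower central series of F1 and F2, which [comm_gamma_l] and [comm_gamma_r]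
    show to commute with the opposite factor. *)
Lemma gamma_split n f :
  f \in gamma F n.+2 -> (split_part f)^-1 * f \in iter_commutator K n.
Proof.
elim: n f => [|n IHn] f gf; first exact: split_cartesian.
have nKn := iter_commutator_normal (c := n.+1) (@cartesian_normal F1 F2).
have [Q [q [qK q_surj]]] := quotient_exists nKn; apply/(quotient_eq qK).
have qT1 t y : t \in gamma F1 n.+2 -> commute (q (i1 t)) (q (i2 y)).
  by move=> gt; apply/(quotient_commute qK)/comm_gamma_l.
have qT2 t x : t \in gamma F2 n.+2 -> commute (q (i2 t)) (q (i1 x)).
  by move=> gt; apply/(quotient_commute qK)/comm_gamma_r.
have gsub (A B : groupType) (h : {multiplicative A -> B}) x :
    x \in gamma A n.+2 -> h x \in gamma B n.+2 by exact: hom_gamma.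
suff /and3P[_ _ /eqP] : f \in split_mod_group qT1 qT2 by [].
move: f gf; apply: gamma_min => s f gs.
apply: split_mod_comm => //; try exact: gamma_normal; try exact: gsub.
apply: (quotient_central qK) => // y.
by apply/mem_iter_commutatorS/IHn.
Qed.

(** An element of weight n+2 that is trivial in F1 x F2 involves both factors,
    and one of its n+1 brackets is spent on producing an element of K. *)
Lemma cartesian_gamma n w :
  w \in K -> w \in gamma F n.+2 -> w \in iter_commutator K n.
Proof.
by move=> Kw /gamma_split; rewrite split_part_cartesian // invg1 mul1g.
Qed.

End CartesianGamma.

(** * The relators of a free product *)

(** The part of the structure of the kernel S of F -> G * H, with R1 and R2 the
    kernels of F1 -> G and F2 -> H, on which the argument rests.  The last
    clause says that S is the product of R1, R2 and [S, F]. *)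
Record relator_system (F1 F2 : groupType) (S : groupClosed (free_product F1 F2))
    (R1 : groupClosed F1) (R2 : groupClosed F2) : Prop := RelatorSystem {
  rel_normal : is_normal S;
  rel_normal_l : is_normal R1;
  rel_normal_r : is_normal R2;
  rel_inl : forall r, r \in R1 -> fp_inl F1 F2 r \in S;
  rel_inr : forall r, r \in R2 -> fp_inr F1 F2 r \in S;
  rel_prl : forall s, s \in S -> fp_prl F1 F2 s \in R1;
  rel_prr : forall s, s \in S -> fp_prr F1 F2 s \in R2;
  rel_split : forall s, s \in S -> (split_part s)^-1 * s \in iter_commutator S 1
}.

Section FreeProductKernel.
Variables (F1 F2 G H : groupType).
Variables (fG : {multiplicative F1 -> G}) (fH : {multiplicative F2 -> H}).
Hypotheses (fG_surj : forall g, exists x, fG x = g).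
Hypotheses (fH_surj : forall h, exists y, fH y = h).
Variable f : {multiplicative free_product F1 F2 -> free_product G H}.
Hypothesis f_inl : forall x, f (fp_inl F1 F2 x) = fp_inl G H (fG x).
Hypothesis f_inr : forall y, f (fp_inr F1 F2 y) = fp_inr G H (fH y).

Local Notation F := (free_product F1 F2).
Local Notation i1 := (fp_inl F1 F2).
Local Notation i2 := (fp_inr F1 F2).
Local Notation p1 := (fp_prl F1 F2).
Local Notation p2 := (fp_prr F1 F2).

Lemma kernel_inl r : r \in kernel fG -> i1 r \in kernel f.
Proof. by move=> /eqP r1; apply/eqP; rewrite f_inl r1 hom_one. Qed.
Lemma kernel_inr r : r \in kernel fH -> i2 r \in kernel f.
Proof. by move=> /eqP r1; apply/eqP; rewrite f_inr r1 hom_one. Qed.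

Lemma fp_prl_map x : fG (p1 x) = fp_prl G H (f x).
Proof.
apply: (free_product_hom_ext (f := fG \o p1) (g := fp_prl G H \o f)) => y /=.
  by rewrite f_inl !fp_prE.
by rewrite f_inr !fp_prE hom_one.
Qed.
Lemma fp_prr_map x : fH (p2 x) = fp_prr G H (f x).
Proof.
apply: (free_product_hom_ext (f := fH \o p2) (g := fp_prr G H \o f)) => y /=.
  by rewrite f_inl !fp_prE hom_one.
by rewrite f_inr !fp_prE.
Qed.

Lemma kernel_prl s : s \in kernel f -> p1 s \in kernel fG.
Proof. by move=> /eqP s1; apply/eqP; rewrite fp_prl_map s1 hom_one. Qed.
Lemma kernel_prr s : s \in kernel f -> p2 s \in kernel fH.
Proof. by move=> /eqP s1; apply/eqP; rewrite fp_prr_map s1 hom_one. Qed.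

(** Since R1 and R2 are central modulo [S, F], the product of R1, R2 and [S, F]
    is a normal subgroup of F.  The quotient of F by it receives G and H, hence
    G * H, so it contains the kernel S. *)
Lemma kernel_split s : s \in kernel f ->
  (split_part s)^-1 * s \in iter_commutator (kernel f) 1.
Proof.
move=> fs; have nS : is_normal (kernel f) by move=> x y; apply: kernel_conj.
have nS1 := iter_commutator_normal (c := 1) nS.
have [Q [q [qK q_surj]]] := quotient_exists nS1; apply/(quotient_eq qK).
have qS s' z : s' \in kernel f -> commute (q s') (q z).
  by move=> fs'; apply/(quotient_commute qK)/mem_commutator.
have nR1 : is_normal (kernel fG) by move=> x y; apply: kernel_conj.
have nR2 : is_normal (kernel fH) by move=> x y; apply: kernel_conj.
have qT1 t y : t \in kernel fG -> commute (q (i1 t)) (q (i2 y)).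
  by move=> /kernel_inl; exact: qS.
have qT2 t x : t \in kernel fH -> commute (q (i2 t)) (q (i1 x)).
  by move=> /kernel_inr; exact: qS.
pose P := split_mod_group qT1 qT2.
have nP : is_normal P.
  move=> x y Px; have -> : x ^ y = x * [~ x, y] by rewrite /commg mulVKg.
  case/and3P: (Px) => x1 x2 /eqP xE.
  apply: gpredM => //; apply: split_mod_comm => //.
  by rewrite hom_mul hom_inv xE mulVg; exact: central1.
have [Q' [q' [qP _]]] := quotient_exists nP.
have q'l r : fG r = 1 -> q' (i1 r) = 1.
  move=> /eqP fr; apply/qP/and3P; rewrite /split_part !fp_prE.
  by rewrite hom_one mulg1; split=> //; exact: gpred1.
have q'r r : fH r = 1 -> q' (i2 r) = 1.
  move=> /eqP fr; apply/qP/and3P; rewrite /split_part !fp_prE.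
  by rewrite hom_one mul1g; split=> //; exact: gpred1.
have [h1 h1E] := hom_factor (f := q' \o i1) fG_surj q'l.
have [h2 h2E] := hom_factor (f := q' \o i2) fH_surj q'r.
have [h [hl hr]] := free_product_lift h1 h2.
have hf : h \o f =1 q'.
  apply: free_product_hom_ext => x /=; first by rewrite f_inl hl h1E.
  by rewrite f_inr hr h2E.
suff /and3P[_ _ /eqP] : s \in P by [].
by apply/qP; rewrite -hf /= (eqP fs) hom_one.
Qed.

Lemma kernel_relator_system :
  relator_system (kernel f) (kernel fG) (kernel fH).
Proof.
split=> *; solve [exact: kernel_conj | exact: kernel_inl | exact: kernel_inr |
                  exact: kernel_prl | exact: kernel_prr | exact: kernel_split].
Qed.

End FreeProductKernel.

Section Relators.
Variables F1 F2 : groupType.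

Local Notation F := (free_product F1 F2).
Local Notation i1 := (fp_inl F1 F2).
Local Notation i2 := (fp_inr F1 F2).
Local Notation p1 := (fp_prl F1 F2).
Local Notation p2 := (fp_prr F1 F2).
Local Notation K := (cartesian F1 F2).

Variables (S : groupClosed F) (R1 : groupClosed F1) (R2 : groupClosed F2).
Hypothesis rel : relator_system S R1 R2.

Let nS := rel_normal rel.
Let nR1 := rel_normal_l rel.
Let nR2 := rel_normal_r rel.
Let S_inl := rel_inl rel.
Let S_inr := rel_inr rel.
Let S_prl := rel_prl rel.
Let S_prr := rel_prr rel.
Let S_split := rel_split rel.

Local Notation V := (subgroupI K S).

Lemma cartesian_relators w : w \in V -> w \in iter_commutator S 1.
Proof.
by case/andP=> Kw /S_split; rewrite split_part_cartesian // invg1 mul1g.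
Qed.

Lemma V_normal : is_normal V.
Proof. exact: subgroupI_normal (@cartesian_normal _ _) nS. Qed.

Lemma split_part_S s : s \in S -> split_part s \in S.
Proof. by move=> Ss; apply: gpredM; [exact/S_inl/S_prl|exact/S_inr/S_prr]. Qed.

Lemma comm_V_l r y : r \in R1 -> [~ i1 r, i2 y] \in V.
Proof.
move=> Rr; apply/andP; split; first exact: comm_cartesian.
exact/normal_comml/S_inl.
Qed.

Lemma comm_V_r r x : r \in R2 -> [~ i2 r, i1 x] \in V.
Proof.
move=> Rr; apply/andP; split; last exact/normal_comml/S_inr.
by rewrite -invgR gpredV; exact: comm_cartesian.
Qed.

Section Cover.
Hypothesis comm3 : forall x y,
  [~ i1 x, i2 y] \in subgroup_prod (iter_commutator S 1) (@gamma_normal F 3).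

Local Notation S1G n :=
  (subgroup_prod (iter_commutator S 1) (@gamma_normal F n)).

Let nS1 := iter_commutator_normal (c := 1) nS.

(** Each bracket with F raises the weight of the error term by one. *)
Lemma iter_cartesian_cover n k : k \in iter_commutator K n -> k \in S1G n.+3.
Proof.
elim: n k => [|n IHn] k.
  apply: cartesian_min => //; exact: subgroup_prod_normal.
move: k; apply: iter_commutator_min => k f /IHn /subgroup_prodP[s [g [Ss Gg ->]]].
rewrite comm_mull; apply: gpredM.
  by apply/subgroup_prodl/nS1/normal_comml.
by apply/subgroup_prodr/mem_gammaS.
Qed.

(** Dividing s by its split part moves it into K; the split part of s is the
    inverse of that of g up to order, so it stays in gamma_n(F). *)
Lemma cover_cartesian n k : k \in K -> k \in S1G n ->
  exists v g, [/\ v \in V, g \in gamma F n & k = v * g].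
Proof.
move=> Kk /subgroup_prodP[s [g [Ss Gg kE]]].
have {}Ss : s \in S by exact: (iter_commutator_sub_le (m := 0) nS _ Ss).
exists (s * (split_part s)^-1), (split_part s * g); split.
- apply/andP; split; first by apply: normal_swap (split_cartesian s); exact: cartesian_normal.
  by apply: gpredM => //; rewrite gpredV split_part_S.
- apply: gpredM => //; move: Kk; rewrite kE.
  move=> /cartesianP[]; rewrite !hom_mul => /mulg1_eq s1 /mulg1_eq s2.
  rewrite /split_part -(invgK (p1 s)) -(invgK (p2 s)) s1 s2 !hom_inv.
  by apply: gpredM; rewrite gpredV; apply: hom_gamma; exact: hom_gamma.
- by rewrite kE mulgA mulgVK.
Qed.

(** The error g of weight n+3 is itself in K, hence in [K, _(n+1) F] by
    [cartesian_gamma], where [iter_cartesian_cover] improves its weight. *)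
Lemma cartesian_cover n k : k \in K ->
  exists v g, [/\ v \in V, g \in gamma F n.+3 & k = v * g].
Proof.
move=> Kk; apply: cover_cartesian => //.
elim: n k Kk => [|n IHn] k Kk.
  exact: (iter_cartesian_cover (n := 0)).
have [v [g [Vv Gg kE]]] := cover_cartesian Kk (IHn _ Kk).
rewrite kE; apply: gpredM; first by apply/subgroup_prodl/cartesian_relators.
apply: (iter_cartesian_cover (n := n.+1)); apply: cartesian_gamma => //.
by move: Kk; rewrite kE gpredMl //; case/andP: Vv.
Qed.

(** Modulo [V, F] [S, _(n+2) F] the subgroup V is central, so [cartesian_cover]
    makes all of K commute with S.  Then [R1, F1] commutes with F2 by
    [derived_commutes], and likewise for the other factor, so by
    [split_mod_comm] an element of [S, _2 F] equals its split part. *)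
Lemma cartesian_iter2 n w (nSn : is_normal (iter_commutator S n.+2)) :
  w \in K -> w \in iter_commutator S 2 ->
  w \in subgroup_prod (commutator V (whole F)) nSn.
Proof.
move=> Kw Sw; have nVF := commutator_normal V_normal (@whole_normal F).
have nP := subgroup_prod_normal (nB := nSn) nVF.
have [Q [q [qK q_surj]]] := quotient_exists nP; apply/qK.
have qV v : v \in V -> central (q v).
  move=> Vv; apply: (quotient_central qK) => // z.
  by apply/subgroup_prodl/mem_commutator.
have qKS k s : k \in K -> s \in S -> commute (q k) (q s).
  move=> /(cartesian_cover n)[v [g [Vv Gg ->]]] Ss; rewrite hom_mul.
  apply/commute_sym/commuteM; first exact/commute_sym/qV.
  apply/(quotient_commute qK)/subgroup_prodr.
  apply: (iter_commutator_sub_le nS (leqnSn _)).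
  exact: (iter_commutator_gamma (j := 0) (k := n.+2)).
have qT1 t y : t \in iter_commutator R1 1 -> commute (q (i1 t)) (q (i2 y)).
  apply: (@derived_commutes _ _ _ (q \o i1) (q \o i2) R1) => //= [r z Rr|x z r Rr].
    by rewrite -hom_comm; apply: qV; exact: comm_V_l.
  by rewrite -hom_comm; apply: qKS; [exact: comm_cartesian|exact: S_inl].
have qT2 t y : t \in iter_commutator R2 1 -> commute (q (i2 t)) (q (i1 y)).
  apply: (@derived_commutes _ _ _ (q \o i2) (q \o i1) R2) => //= [r z Rr|x z r Rr].
    by rewrite -hom_comm; apply: qV; exact: comm_V_r.
  rewrite -hom_comm; apply: qKS; last exact: S_inr.
  by rewrite -invgR gpredV; exact: comm_cartesian.
suff /and3P[_ _ /eqP ->] : w \in split_mod_group qT1 qT2.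
  by rewrite split_part_cartesian // hom_one.
move: w Kw Sw => w _; move: w; apply: iter_commutator_min => s f Ss.
have S0 : s \in S by exact: (iter_commutator_sub_le (m := 0) nS _ Ss).
apply: split_mod_comm.
- exact: (iter_commutator_normal (c := 1)).
- exact: (iter_commutator_normal (c := 1)).
- exact: hom_iter_commutator Ss.
- exact: hom_iter_commutator Ss.
- apply: qV; apply/andP; split; first exact: split_cartesian.
  by rewrite gpredMl // gpredV split_part_S.
Qed.

End Cover.

End Relators.

(** * Deforming the cartesian subgroup into the relators *)

Section WreathProduct.
Variables E F : groupType.

(** The unrestricted wreath product of F by E: E acts on functions from E to F
    by right translation. *)
Definition wreath := (E * (E -> F))%type.
HB.instance Definition _ := Choice.on wreath.

Definition wr_mul (a b : wreath) : wreath :=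
  (a.1 * b.1, fun u => a.2 u * b.2 (u * a.1)).
Definition wr_one : wreath := (1, fun _ => 1).
Definition wr_inv (a : wreath) : wreath := (a.1^-1, fun u => (a.2 (u * a.1^-1))^-1).

Lemma wr_mulA : associative wr_mul.
Proof.
move=> a b c; congr pair; first exact: mulgA.
by apply/funext => u; rewrite /= !mulgA.
Qed.
Lemma wr_mul1 : left_id wr_one wr_mul.
Proof.
case=> a f; congr pair; first exact: mul1g.
by apply/funext => u; rewrite /= mul1g mulg1.
Qed.
Lemma wr_1mul : right_id wr_one wr_mul.
Proof.
by case=> a f; congr pair; [exact: mulg1|apply/funext => u; exact: mulg1].
Qed.
Lemma wr_mulV : left_inverse wr_one wr_inv wr_mul.
Proof.
case=> a f; congr pair; first exact: mulVg.
by apply/funext => u; exact: mulVg.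
Qed.
Lemma wr_mulgV : right_inverse wr_one wr_inv wr_mul.
Proof.
case=> a f; congr pair; first exact: mulgV.
by apply/funext => u; rewrite /= mulgK mulgV.
Qed.
HB.instance Definition _ :=
  isGroup.Build wreath wr_mulA wr_mul1 wr_1mul wr_mulV wr_mulgV.

End WreathProduct.

(** A map m with these properties is a homomorphism from the free product to
    the wreath product of E by F1, trivial on F1, that covers the projection to
    F1.  It exists for every theta because F2 is free. *)
Lemma twisted_hom_exists (F1 E : groupType) (X2 : choiceType)
    (theta : X2 -> F1 -> E) :
  exists m : free_product F1 (free_group X2) -> F1 -> E,
    [/\ forall f f' u,
          m (f * f') u = m f u * m f' (u * fp_prl F1 (free_group X2) f),
        forall x u, m (fp_inl F1 (free_group X2) x) u = 1 &
        forall y u, m (fp_inr F1 (free_group X2) (gen y)) u = theta y u].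
Proof.
pose h1 (x : F1) : wreath F1 E := (x, fun _ => 1).
have h1M : {morph h1 : x y / x * y}.
  by move=> x y; congr pair; apply/funext => u /=; rewrite mulg1.
have [h2 h2E] := free_group_lift (fun y => (1, theta y) : wreath F1 E).
have [M [Ml Mr]] := free_product_lift (hom_of h1M) h2.
have fstM : {morph (fun a : wreath F1 E => a.1) : x y / x * y} by [].
have M1 f : (M f).1 = fp_prl F1 (free_group X2) f.
  apply: (free_product_hom_ext (f := hom_of fstM \o M)) => x /=.
    by rewrite Ml fp_prE.
  rewrite Mr fp_prE.
  apply: (free_group_hom_ext (f := hom_of fstM \o h2) (g := hom_of (@trivial_homM _ _))).
  by move=> {}x /=; rewrite h2E.
exists (fun f => (M f).2); split=> [f f' u|x u|y u].
- by rewrite hom_mul /= M1.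
- by rewrite Ml.
- by rewrite Mr h2E.
Qed.

Section Deformation.
Variables X1 X2 : choiceType.

Local Notation F1 := (free_group X1).
Local Notation F2 := (free_group X2).
Local Notation F := (free_product F1 F2).
Local Notation i1 := (fp_inl F1 F2).
Local Notation i2 := (fp_inr F1 F2).
Local Notation p1 := (fp_prl F1 F2).
Local Notation p2 := (fp_prr F1 F2).
Local Notation K := (cartesian F1 F2).

(** In the application C is gamma_(n+1)(F), V is the intersection of K and S,
    and N is [S, _n F]. *)
Variables (C V N : groupClosed F).
Hypotheses (nC : is_normal C) (nV : is_normal V) (nN : is_normal N).
Hypothesis CV : forall g v, g \in C -> v \in V -> [~ g, v] \in N.
Hypothesis cover : forall k, k \in K ->
  exists v g, [/\ v \in V, g \in C & k = v * g].

(** Conjugation by the basis element y of F2 is a homomorphism from F1 to F;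
    replacing x ^ y = x [x, y] by x v, with v in V congruent to [x, y] modulo C,
    defines a homomorphism because F1 is free. *)
Lemma deformation_gen : exists xi : X2 -> {multiplicative F1 -> F},
  (forall y u, (xi y u)^-1 * i1 u ^ i2 (gen y) \in C) /\
  (forall y u, (xi y u)^-1 * i1 u \in V).
Proof.
have cX x y : exists v, v \in V /\ v^-1 * [~ i1 (gen x), i2 (gen y)] \in C.
  have [v [g [Vv Cg ->]]] := cover (comm_cartesian (gen x) (gen y)).
  by exists v; rewrite mulKg.
pose c x y := projT1 (cid (cX x y)).
have cV x y : c x y \in V by rewrite /c; case: cid => v [].
have cC x y : (c x y)^-1 * [~ i1 (gen x), i2 (gen y)] \in C.
  by rewrite /c; case: cid => v [].
pose xi y := sval (free_group_lift (fun x => i1 (gen x) * c x y)).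
have xiE y x : xi y (gen x) = i1 (gen x) * c x y.
  by rewrite /xi; case: free_group_lift.
exists xi; split=> y u.
  have [Q [q [qC _]]] := quotient_exists nC; apply/(quotient_eq qC).
  have conjM : {morph (fun w : F => w ^ i2 (gen y)) : a b / a * b}.
    by move=> a b; exact: conjMg.
  apply: (free_group_hom_ext (f := q \o xi y) (g := q \o (hom_of conjM \o i1))).
  move=> x; rewrite /= xiE; apply/(quotient_eq qC).
  by rewrite invgM -mulgA -commgEl.
have [Q [q [qV _]]] := quotient_exists nV; apply/(quotient_eq qV).
apply: (free_group_hom_ext (f := q \o xi y) (g := q \o i1)) => x.
by rewrite /= xiE hom_mul ((qV _).2 (cV _ _)) mulg1.
Qed.

(** The deformation is the map sigma k = (mu k)^-1 * k from K to V.  It is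
    F-equivariant modulo N and moves each k by an element mu k of C.  Such a
    sigma is determined by its values on the commutators [x, y] of basis
    elements, which can be prescribed since the abelianization of K is a free
    module over the group ring of F1 x F2; here the prescribed values come from
    [deformation_gen], and the freeness is replaced by [twisted_hom_exists]:
    mu k is the value at 1 of the function attached to k. *)
Lemma deformation_exists : exists mu : F -> F,
  [/\ forall k k', k \in K -> mu (k * k') = mu k * mu k',
      forall k f, k \in K -> (mu (k ^ f))^-1 * mu k ^ f \in N,
      forall k, k \in K -> mu k \in C &
      forall k, k \in K -> (mu k)^-1 * k \in V].
Proof.
have [xi [xiC xiV]] := deformation_gen.
have [m [mM m_l m_r]] :=
  twisted_hom_exists (fun y u => i1 u * i2 (gen y) * (xi y u)^-1).
have [Q [q [qN _]]] := quotient_exists nN.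
have [QC [qC [qCP _]]] := quotient_exists nC.
have [QV [qV [qVP _]]] := quotient_exists nV.
have m_1 u : m 1 u = 1.
  by apply: (@mulgI _ (m 1 u)); rewrite mulg1 -{2}[u]mulg1 -(hom_one p1) -mM mulg1.
have m_V f u : m f^-1 u = (m f (u * (p1 f)^-1))^-1.
  apply/esym/mulg1_eq; rewrite -[u in m f^-1 u](mulgVK (p1 f)) -mM mulgV.
  exact: m_1.
have mrM u : {morph (fun y => m (i2 y) u) : a b / a * b}.
  by move=> a b; rewrite hom_mul mM fp_prE mulg1.
(* Modulo C, where xi y u is u ^ y, m does not depend on u; modulo V, where
   xi y u is u, it is the conjugate of f (p1 f)^-1 by u^-1. *)
have m_C f u : qC (m f u) = qC (i2 (p2 f)).
  move: f u; apply: free_product_ind => [|x w IHw|y w IHw] u.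
  - by rewrite m_1 !hom_one.
  - by rewrite mM m_l mul1g IHw (hom_mul p2) fp_prE mul1g.
  rewrite mM (hom_mul qC) IHw !hom_mul !fp_prE; congr (_ * _).
  apply: (free_group_hom_ext (f := qC \o hom_of (mrM u)) (g := qC \o i2)) => {}y.
  rewrite /= m_r; have /(quotient_eq qCP) /esym xiE := xiC y u.
  by rewrite !hom_mul hom_inv -xiE hom_conj /conjg !gnorm.
have m_Vv f u : qV (m f u) = qV (i1 u * f * (i1 (u * p1 f))^-1).
  move: f u; apply: free_product_ind => [|x w IHw|y w IHw] u.
  - by rewrite m_1 !hom_one !mulg1 mulgV hom_one.
  - by rewrite mM m_l mul1g IHw !hom_mul !fp_prE !mulgA.
  rewrite mM (hom_mul qV) IHw !(hom_mul p1) !fp_prE mul1g !mulg1.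
  rewrite !(hom_mul qV) !mulgA; congr (_ * _ * _).
  have conjM : {morph (fun w : F => w ^ (i1 u)^-1) : a b / a * b}.
    by move=> a b; exact: conjMg.
  suff -> : qV (m (i2 y) u) = qV (i2 y ^ (i1 u)^-1).
    by rewrite /conjg invgK !hom_mul hom_inv !gnorm.
  apply: (free_group_hom_ext (f := qV \o hom_of (mrM u))
    (g := qV \o (hom_of conjM \o i2))) => {}y.
  rewrite /= m_r; have /(quotient_eq qVP) /esym xiE := xiV y u.
  by rewrite /conjg invgK !hom_mul hom_inv -xiE hom_inv mulgA.
have m_KC k u : k \in K -> m k u \in C.
  case/cartesianP=> _ k2; apply/qCP; rewrite m_C k2 hom_one; exact: hom_one.
have qCV g v : g \in C -> v \in V -> commute (q g) (q v).
  by move=> Cg Vv; apply/(quotient_commute qN)/CV.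
have qCJ g a b : g \in C -> a^-1 * b \in V -> q g ^ q a = q g ^ q b.
  move=> Cg Vab; rewrite -(mulVKg a b) hom_mul conjgM -hom_conj.
  rewrite (commute_conj (qCV _ _ _ Vab)) //; exact: nC.
have m_r_V y u : (i1 u * i2 y * (i1 u)^-1)^-1 * m (i2 y) u \in V.
  by apply/(quotient_eq qVP); rewrite m_Vv fp_prE mulg1.
have mJ_l k a u : m (k ^ i1 a) u = m k (u * a^-1).
  by rewrite /conjg -hom_inv !mM !m_l !fp_prE mul1g mulg1.
have mJ_r k y u : k \in K -> m (k ^ i2 y) u = m k u ^ m (i2 y) u.
  case/cartesianP=> k1 _.
  by rewrite /conjg !mM m_V hom_inv fp_prE k1 invg1 !mulg1.
(* The equivariance of mu follows from this description of m k; the k that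
   satisfy it form a normal subgroup, so [cartesian_min] reduces it to
   commutators. *)
pose Jp (k : F) := k \in K /\ forall u, q (m k u) = q (m k 1) ^ q (i1 u)^-1.
have Jp1 : Jp 1.
  by split=> [|u]; [exact: gpred1|rewrite !m_1 hom_one conj1g].
have JpM a b : Jp a -> Jp b -> Jp (a * b).
  move=> [Ka Ja] [Kb Jb]; split=> [|u]; first exact: gpredM.
  have /cartesianP[a1 _] := Ka.
  by rewrite !mM a1 !mulg1 !(hom_mul q) conjMg Ja Jb.
have JpV a : Jp a -> Jp a^-1.
  move=> [Ka Ja]; split=> [|u]; first exact: gpredVr.
  have /cartesianP[a1 _] := Ka.
  by rewrite !m_V a1 invg1 !mulg1 !(hom_inv q (m _ _)) conjVg Ja.
have JpJl k x : Jp k -> Jp (k ^ i1 x).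
  move=> [Kk Jk]; split=> [|u]; first exact: cartesian_normal.
  by rewrite !mJ_l Jk (Jk (1 * _)) mul1g -conjgM -(hom_mul q) (hom_mul i1) invgM.
have JpJr k y : Jp k -> Jp (k ^ i2 y).
  move=> [Kk Jk]; split=> [|u]; first exact: cartesian_normal.
  rewrite !mJ_r // !(hom_conj q) Jk -!conjgM -!(hom_mul q).
  have Ck := m_KC k 1 Kk.
  have y1 : (i2 y)^-1 * m (i2 y) 1 \in V.
    by have := m_r_V y 1; rewrite hom_one invg1 mulg1 mul1g.
  rewrite -(qCJ _ (i2 y * (i1 u)^-1) _ Ck).
    apply: qCJ => //; have := nV (i1 u)^-1 y1.
    by rewrite /conjg !invgM !invgK !mulgA.
  by have := m_r_V y u; rewrite !invgM !invgK !mulgA.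
pose J : groupClosed F :=
  let P : {pred F} := fun k => `[< Jp k >] in
  HB.pack P
    (isMulClosed.Build _ P (fun a b Ja Jb =>
      introT (asboolP _) (JpM _ _ (elimT (asboolP _) Ja) (elimT (asboolP _) Jb))))
    (isMul1Closed.Build _ P (introT (asboolP _) Jp1))
    (isInvClosed.Build _ P (fun a Ja =>
      introT (asboolP _) (JpV _ (elimT (asboolP _) Ja)))).
have JE k : reflect (Jp k) (k \in J) by exact: asboolP.
have nJ : is_normal J.
  move=> k w /JE Jk; apply/JE; move: w k Jk.
  apply: free_product_ind => [|x w IHw|y w IHw] k Jk.
  - by rewrite conjg1.
  - by rewrite conjgM; apply/IHw/JpJl.
  - by rewrite conjgM; apply/IHw/JpJr.
have J_gen x y : Jp [~ i1 x, i2 (gen y)].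
  split=> [|u]; first exact: comm_cartesian.
  have mE z : m [~ i1 x, i2 (gen y)] z =
      ((xi y x)^-1 * i1 x ^ i2 (gen y)) ^ (xi y z)^-1.
    rewrite /commg /conjg -(hom_inv i1) mM m_l mul1g mM m_V mM m_l mul1g.
    rewrite !m_r !hom_inv !fp_prE invg1 !mulg1 !hom_mul !hom_inv !invgM !invgK.
    by rewrite !gnorm.
  rewrite !mE (hom_one (xi y)) invg1 conjg1 (hom_conj q).
  by apply: qCJ => //; rewrite invgK -gpredV invgM invgK; exact: normal_swap.
have KJ k : k \in K -> Jp k.
  move=> Kk; apply/JE; move: k Kk; apply: cartesian_min => // x y.
  have [QJ [qJ [qJP _]]] := quotient_exists nJ; apply/(quotient_commute qJP).
  pose c := hom_preim (qJ \o i2) (centraliser (fun z => exists x, z = qJ (i1 x))).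
  suff: y \in c by move/centraliserP; apply; exists x.
  apply: free_group_gen => {}y; apply/centraliserP => _ [{}x ->].
  by apply/(quotient_commute qJP)/JE/J_gen.
exists (fun k => m k 1); split.
- by move=> k k' /cartesianP[k1 _]; rewrite mM k1 mulg1.
- move=> k f Kk; apply/(quotient_eq qN); rewrite hom_conj; move: f k Kk.
  apply: free_product_ind => [|x w IHw|y w IHw] k Kk.
  + by rewrite conjg1 hom_one conjg1.
  + rewrite (hom_mul q) !conjgM IHw; last exact: cartesian_normal.
    rewrite mJ_l; have [_ ->] := KJ k Kk.
    by rewrite mul1g (hom_inv i1) invgK.
  + rewrite (hom_mul q) !conjgM IHw; last exact: cartesian_normal.
    rewrite mJ_r // hom_conj; congr (_ ^ _); apply/esym/qCJ; first exact: m_KC.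
    by have := m_r_V y 1; rewrite hom_one invg1 mulg1 mul1g.
- by move=> k Kk; exact: m_KC.
- move=> k /cartesianP[k1 _]; apply/(quotient_eq qVP).
  by rewrite m_Vv k1 mulg1 hom_one mul1g invg1 mulg1.
Qed.

End Deformation.

(** * The inductive step *)

Section InductiveStep.
Variables X1 X2 : choiceType.

Local Notation F1 := (free_group X1).
Local Notation F2 := (free_group X2).
Local Notation F := (free_product F1 F2).
Local Notation i1 := (fp_inl F1 F2).
Local Notation i2 := (fp_inr F1 F2).
Local Notation K := (cartesian F1 F2).

Variables (S : groupClosed F) (R1 : groupClosed F1) (R2 : groupClosed F2).
Hypothesis rel : relator_system S R1 R2.
Let nS := rel_normal rel.

Local Notation V := (subgroupI K S).

Hypothesis comm3 : forall x y,
  [~ i1 x, i2 y] \in subgroup_prod (iter_commutator S 1) (@gamma_normal F 3).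
Variable n : nat.
Hypothesis base : forall w, w \in V -> w \in gamma F 3 -> w \in iter_commutator S 2.
Hypothesis IH : forall w, w \in V -> w \in gamma F n.+3 ->
  w \in iter_commutator S n.+2.

Local Notation Sn := (iter_commutator S n.+3).

Section Deformed.
Variable mu : F -> F.
Hypothesis muM : forall k k', k \in K -> mu (k * k') = mu k * mu k'.
Hypothesis muJ : forall k f, k \in K -> (mu (k ^ f))^-1 * mu k ^ f \in Sn.
Hypothesis mu_gamma : forall k, k \in K -> mu k \in gamma F n.+4.
Hypothesis muV : forall k, k \in K -> (mu k)^-1 * k \in V.

Let nSn : is_normal Sn := iter_commutator_normal nS.

Let mu1 : mu 1 = 1.
Proof. by apply: (@mulgI _ (mu 1)); rewrite -muM ?gpred1 // !mulg1. Qed.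

Let mu_inv k : k \in K -> mu k^-1 = (mu k)^-1.
Proof. by move=> Kk; apply/esym/mulg1_eq; rewrite -muM // mulgV mu1. Qed.

(** For v in V the element mu v is in V and in gamma_(n+4)(F), so by induction it
    is in [S, _(n+2) F] and central modulo [S, _(n+3) F]; by equivariance mu v
    and mu (v ^ f) agree there. *)
Lemma deformed_commutator w : w \in commutator V (whole F) -> mu w \in Sn.
Proof.
pose P : {pred F} := fun k => (k \in K) && (mu k \in Sn).
have PM : mulg_closed P.
  move=> a b /andP[Ka Sa] /andP[Kb Sb]; apply/andP; split; first exact: gpredM.
  by rewrite muM // gpredM.
have P1 : 1 \in P by apply/andP; rewrite mu1 !gpred1.
have PV : invg_closed P.
  move=> a /andP[Ka Sa]; apply/andP; split; first exact: gpredVr.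
  by rewrite mu_inv // gpredV.
pose D : groupClosed F := HB.pack P (isMulClosed.Build _ P PM)
  (isMul1Closed.Build _ P P1) (isInvClosed.Build _ P PV).
suff VD v : v \in commutator V (whole F) -> v \in D by move=> /VD /andP[].
move: v; apply: commutator_min => v f Vv _; have /andP[Kv Sv] := Vv.
apply/andP; split; first exact: normal_comml (@cartesian_normal _ _) Kv.
have Vmu : mu v \in V.
  by rewrite -(gpredMr (x := (mu v)^-1 * v)) ?muV // mulVKg.
have Smu : mu v \in iter_commutator S n.+2.
  by apply: IH => //; apply: (gamma_sub_le (leqnSn _)); exact: mu_gamma.
have [Q [q [qN q_surj]]] := quotient_exists nSn; apply/qN.
have c_mu : central (q (mu v)).
  by apply: (quotient_central qN) => // z; exact: mem_iter_commutatorS.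
have := muJ f Kv; move/(quotient_eq qN); rewrite hom_conj.
rewrite (commute_conj (c_mu _)) commgEl (@muM v^-1) ?gpredV // mu_inv // hom_mul => ->.
by rewrite hom_inv mulVg.
Qed.

(** The deformation sends K into V, hence into [S, F], and by equivariance it is
    compatible with each further bracket with F. *)
Lemma deformed_iter j k : j <= n.+2 -> k \in iter_commutator K j ->
  (mu k)^-1 * k \in iter_commutator S j.+1.
Proof.
elim: j k => [|j IHj] k jn Kk; first exact/(cartesian_relators rel)/muV.
pose T := iter_commutator S j.+2.
have nT : is_normal T := iter_commutator_normal nS.
have sigmaM a b : a \in K -> (mu (a * b))^-1 * (a * b) =
    ((mu a)^-1 * a) ^ mu b * ((mu b)^-1 * b).
  by move=> Ka; rewrite muM // /conjg !gnorm.
pose P : {pred F} := fun k => (k \in K) && ((mu k)^-1 * k \in T).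
have PM : mulg_closed P.
  move=> a b /andP[Ka Sa] /andP[Kb Sb]; apply/andP; split; first exact: gpredM.
  by rewrite sigmaM //; apply: gpredM => //; exact: nT.
have P1 : 1 \in P by apply/andP; rewrite mu1 invg1 mulg1 !gpred1.
have PV : invg_closed P.
  move=> a /andP[Ka Sa]; apply/andP; split; first exact: gpredVr.
  rewrite mu_inv // invgK; have := nT _ a^-1 Sa.
  by rewrite /conjg !gnorm -gpredV invgM invgK.
pose D : groupClosed F := HB.pack P (isMulClosed.Build _ P PM)
  (isMul1Closed.Build _ P P1) (isInvClosed.Build _ P PV).
suff KD v : v \in iter_commutator K j.+1 -> v \in D by case/KD/andP: Kk.
move: v; apply: iter_commutator_min => {Kk}k f Kk.
have K0 : k \in K by exact: (iter_commutator_sub_le (m := 0) (@cartesian_normal _ _) _ Kk).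
have Kc : [~ k, f] \in K by exact: normal_comml (@cartesian_normal _ _) K0.
apply/andP; split=> //.
have [Q [q [qN q_surj]]] := quotient_exists nT; apply/qN.
have c_sig : central (q ((mu k)^-1 * k)).
  apply: (quotient_central qN) => // z; apply: mem_iter_commutatorS.
  by apply: IHj => //; exact: ltnW.
have E1 : q ((mu (k ^ f))^-1 * k ^ f) = q ((mu k)^-1 * k).
  have /(iter_commutator_sub_le nS (m := j.+2)) := muJ f K0.
  move=> /(_ jn)/(quotient_eq qN) muE.
  by rewrite hom_mul hom_inv muE -hom_inv -hom_mul -conjVg -conjMg hom_conj
             (commute_conj (c_sig _)).
have := E1; rewrite (_ : k ^ f = k * [~ k, f]); last by rewrite /commg mulVKg.
rewrite sigmaM // hom_mul hom_conj (commute_conj (c_sig _)).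
by rewrite -[RHS]mulg1 => /mulgI.
Qed.

End Deformed.

(** Here w = w' s with w' in [V, F] and s in [S, _(n+3) F].  Then w' is in
    gamma_(n+4)(F), hence in [K, _(n+2) F], and modulo [S, _(n+3) F] both mu w'
    and the deformation of w' are trivial, by [deformed_commutator] and
    [deformed_iter]; w' is their product. *)
Lemma inductive_step w : w \in V -> w \in gamma F n.+4 -> w \in Sn.
Proof.
move=> Vw gw; have /andP[Kw Sw] := Vw.
have nSn : is_normal Sn := iter_commutator_normal nS.
have S2 : w \in iter_commutator S 2 by apply: base => //; apply: gamma_sub_le gw.
have [|||||mu [muM muJ mu_g muV]] := @deformation_exists X1 X2 (gamma F n.+4) V Sn.
- exact: gamma_normal.
- exact: V_normal rel.
- exact: nSn.
- move=> g v gg /andP[_ Sv]; rewrite -invgR gpredV.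
  apply: (iter_commutator_sub_le nS (leqnSn _)).
  exact: (iter_commutator_gamma (j := 0) (k := n.+3)).
- by move=> k; apply: (cartesian_cover rel comm3).
have /subgroup_prodP[w' [s [Vw' Ss wE]]] := cartesian_iter2 rel comm3 nSn Kw S2.
rewrite wE; apply: gpredM => //.
have gs : s \in gamma F n.+4.
  exact: (hom_iter_commutator (f := idfun) (B := whole F)) Ss.
have gw' : w' \in gamma F n.+4 by rewrite -(gpredMr (x := s)) // -wE.
have Kw' : w' \in K.
  move: w' Vw' {wE gw'}; apply: commutator_min => v f /andP[Kv _] _.
  exact: normal_comml (@cartesian_normal _ _) Kv.
rewrite -(mulVKg (mu w') w'); apply: gpredM.
  exact: (deformed_commutator muM muJ).
exact: (deformed_iter muM muJ muV (leqnn _) (cartesian_gamma Kw' gw')).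
Qed.

End InductiveStep.

(** * Tensor products of abelian groups *)

Local Open Scope ring_scope.

Lemma freeg_ind (X : choiceType) (P : {freeg X / int} -> Prop) :
  P 0 -> (forall a b, P a -> P b -> P (a - b)) -> (forall x, P << x >>) ->
  forall a, P a.
Proof.
move=> P0 PB PU a.
have PN b : P b -> P (- b) by move=> Pb; rewrite -sub0r; exact: PB.
have PD b c : P b -> P c -> P (b + c).
  by move=> Pb Pc; rewrite -[c]opprK; apply: PB => //; exact: PN.
rewrite -(freeg_sumE a); apply: big_ind => // x _.
have Pn n : P (<< x >> *+ n) by elim: n => [|n IHn] //; rewrite mulrS; exact: PD.
rewrite -[coeff x a]intz -freegU_mulz; case: (coeff x a) => n; first exact: Pn.
by rewrite NegzE mulrNz; apply/PN/Pn.
Qed.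

Lemma freeg_hom_ext (X : choiceType) (V : zmodType)
    (f g : {additive {freeg X / int} -> V}) :
  (forall x, f << x >> = g << x >>) -> f =1 g.
Proof.
move=> fg; apply: freeg_ind => [|a b fa fb|//]; first by rewrite !raddf0.
by rewrite !raddfB fa fb.
Qed.

Definition additive_of (U V : zmodType) (f : U -> V) (fB : zmod_morphism f) :
  {additive U -> V} := HB.pack f (GRing.isZmodMorphism.Build U V f fB).

Section TensorUniversal.
Variables A B V : zmodType.

Lemma tensor_ind (P : tensor A B -> Prop) :
  P 0 -> (forall s t, P s -> P t -> P (s - t)) ->
  (forall a b, P (tens a b)) -> forall t, P t.
Proof.
move=> P0 PB PT t; rewrite -(tensor_piK t).
apply: (@freeg_ind _ (fun u => P (tensor_pi A B u))) => [|u v Pu Pv|[a b]].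
- by rewrite raddf0.
- by rewrite raddfB; exact: PB.
- exact: PT.
Qed.

Lemma tensor_hom_ext (f g : {additive tensor A B -> V}) :
  (forall a b, f (tens a b) = g (tens a b)) -> f =1 g.
Proof.
move=> fg; apply: tensor_ind => [|s t fs ft|//]; first by rewrite !raddf0.
by rewrite !raddfB fs ft.
Qed.

Lemma tensor_lift (f : A -> B -> V) :
  (forall b, {morph f^~ b : x y / x + y}) -> (forall a, {morph f a : x y / x + y}) ->
  {g : {additive tensor A B -> V} | forall a b, g (tens a b) = f a b}.
Proof.
move=> fDl fDr.
pose h : {additive {freeg (A * B) / int} -> V} := free_ab_lift (fun ab => f ab.1 ab.2).
have hU a b : h << (a, b) >> = f a b by exact: (free_ab_liftU _ (a, b)).
pose g (t : tensor A B) : V := h (repr t).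
have gE u : g (tensor_pi A B u) = h u.
  apply/eqP; rewrite -subr_eq0 -raddfB; apply/eqP.
  have : repr (tensor_pi A B u) - u \in zspan (@bilinear_rel A B).
    by apply/tensor_pi_eq0; rewrite raddfB tensor_piK subrr.
  move/zspanP=> /(_ (additive_kernel h)) Krel; apply/eqP/Krel.
  move=> v [a a' b|a b b']; apply/eqP; rewrite 2!raddfB !hU.
    by rewrite fDl -addrA -opprD subrr.
  by rewrite fDr -addrA -opprD subrr.
have gB : zmod_morphism g.
  move=> s t; rewrite -(tensor_piK s) -(tensor_piK t) -raddfB !gE.
  exact: raddfB.
by exists (additive_of gB) => a b; rewrite /= gE hU.
Qed.

End TensorUniversal.

Section TensorZero.
Variables A B : zmodType.

Lemma tens0r (a : A) : tens a (0 : B) = 0.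
Proof. by apply: (@addrI _ (tens a 0)); rewrite -tensDr !addr0. Qed.
Lemma tens0l (b : B) : tens (0 : A) b = 0.
Proof. by apply: (@addrI _ (tens 0 b)); rewrite -tensDl !addr0. Qed.
Lemma tensNr (a : A) (b : B) : tens a (- b) = - tens a b.
Proof. by apply/eqP; rewrite -addr_eq0 -tensDr addNr tens0r. Qed.
Lemma tensNl (a : A) (b : B) : tens (- a) b = - tens a b.
Proof. by apply/eqP; rewrite -addr_eq0 -tensDl addNr tens0l. Qed.
Lemma tensBr (a : A) (b b' : B) : tens a (b - b') = tens a b - tens a b'.
Proof. by rewrite tensDr tensNr. Qed.
Lemma tensBl (a a' : A) (b : B) : tens (a - a') b = tens a b - tens a' b.
Proof. by rewrite tensDl tensNl. Qed.
End TensorZero.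

Section TensorMapRight.
Variables (A B B' : zmodType) (f : {additive B -> B'}).

Lemma tensor_mapr_exists :
  {g : {additive tensor A B -> tensor A B'} | forall a b, g (tens a b) = tens a (f b)}.
Proof.
apply: tensor_lift => [b x y|a x y]; first exact: tensDl.
by rewrite raddfD tensDr.
Qed.

Definition tensor_mapr : {additive tensor A B -> tensor A B'} := sval tensor_mapr_exists.

Lemma tensor_maprE a b : tensor_mapr (tens a b) = tens a (f b).
Proof. exact: (svalP tensor_mapr_exists). Qed.

Definition ker_incl : {additive ker_of f -> B} := \val.

End TensorMapRight.

Section RightExact.
Variables (A B W : zmodType) (f : {additive B -> W}).
Hypothesis f_surj : forall w, exists b, f b = w.

Definition tensor_image : {pred tensor A B} :=
  fun t => `[< exists u, tensor_mapr A (ker_incl f) u = t >].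

Lemma tensor_image_closed : zmod_closed tensor_image.
Proof.
split; first by apply/asboolP; exists 0; rewrite raddf0.
move=> _ _ /asboolP[u <-] /asboolP[v <-]; apply/asboolP; exists (u - v).
exact: raddfB.
Qed.
HB.instance Definition _ :=
  GRing.isZmodClosed.Build (tensor A B) tensor_image tensor_image_closed.

(** The class of a (x) b modulo the image of A (x) ker f depends only on a and
    f b, which yields a left inverse of A (x) B / image -> A (x) W. *)
Lemma tensor_right_exact t : tensor_mapr A f t = 0 ->
  exists u, tensor_mapr A (ker_incl f) u = t.
Proof.
pose pi : {additive tensor A B -> Quotient.quot tensor_image} :=
  \pi_(Quotient.quot tensor_image).
have pi_eq0 x : pi x = 0 <-> x \in tensor_image by exact: zquot_eq0.
pose s w := projT1 (cid (f_surj w)).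
have sK w : f (s w) = w by rewrite /s; case: cid.
have pi_eq a b b' : f b = f b' -> pi (tens a b) = pi (tens a b').
  move=> fb; apply/eqP; rewrite -subr_eq0 -raddfB -tensBr; apply/eqP/pi_eq0/asboolP.
  have kb : b - b' \in additive_kernel f by rewrite unfold_in raddfB fb subrr.
  by exists (tens a (KerOf kb)); rewrite tensor_maprE.
have [||g gE] := @tensor_lift A W _ (fun a w => pi (tens a (s w))).
- by move=> w x y /=; rewrite tensDl raddfD.
- by move=> a x y /=; rewrite -raddfD -tensDr; apply: pi_eq; rewrite raddfD !sK.
have gpi : g \o tensor_mapr A f =1 pi.
  apply: tensor_hom_ext => a b; rewrite /= tensor_maprE gE; apply: pi_eq.
  exact: sK.
move=> t0; have /asboolP// : t \in tensor_image.
by apply/pi_eq0; rewrite -gpi /= t0 raddf0.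
Qed.

End RightExact.

Section FreeFlat.
Variable X : choiceType.
Local Notation A := {freeg X / int}.

Lemma tensor_coord_exists (V : zmodType) (x : X) :
  {c : {additive tensor A V -> V} | forall a b, c (tens a b) = b *~ coeff x a}.
Proof.
apply: tensor_lift => [b a a'|a b b']; first by rewrite coeffD mulrzDr.
by rewrite mulrzDl.
Qed.

Definition tensor_coord V x : {additive tensor A V -> V} :=
  sval (tensor_coord_exists V x).

Lemma tensor_coordE V x a b : tensor_coord V x (tens a b) = b *~ coeff x a.
Proof. exact: (svalP (tensor_coord_exists V x)). Qed.

(** An element of A (x) V involves finitely many basis elements of A; stating the
    expansion for all large enough supports makes it stable under sums. *)
Lemma tensor_coord_sum V (t : tensor A V) : exists s : seq X,
  forall s', uniq s' -> {subset s <= s'} ->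
    t = \sum_(x <- s') tens << x >> (tensor_coord V x t).
Proof.
have sumB r (t1 t2 : tensor A V) :
    \sum_(x <- r) tens << x >> (tensor_coord V x (t1 - t2)) =
    \sum_(x <- r) tens << x >> (tensor_coord V x t1) -
    \sum_(x <- r) tens << x >> (tensor_coord V x t2).
  by rewrite -sumrB; apply: eq_bigr => x _; rewrite raddfB tensBr.
move: t; apply: tensor_ind => [|t t' [s sE] [s' s'E]|a b].
- exists [::] => s' _ _; rewrite big1 // => x _; by rewrite raddf0 tens0r.
- exists (s ++ s') => r r_uniq sr; rewrite sumB -sE // -?s'E //.
  + by move=> x xs; apply: sr; rewrite mem_cat xs orbT.
  + by move=> x xs; apply: sr; rewrite mem_cat xs.
move: a; apply: freeg_ind => [|a a' [s sE] [s' s'E]|x].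
- exists [::] => s' _ _; rewrite tens0l big1 // => x _; by rewrite raddf0 tens0r.
- exists (s ++ s') => r r_uniq sr; rewrite tensBl sumB -sE // -?s'E //.
  + by move=> x xs; apply: sr; rewrite mem_cat xs orbT.
  + by move=> x xs; apply: sr; rewrite mem_cat xs.
exists [:: x] => r r_uniq /(_ x (mem_head _ _)) xr.
rewrite (bigD1_seq x) //= tensor_coordE coeffU eqxx mulr1 mulr1z big1 ?addr0 //.
by move=> y yx; rewrite tensor_coordE coeffU eq_sym (negPf yx) mulr0 mulr0z tens0r.
Qed.

(** The coordinates of t in V are read off after applying the injection g. *)
Lemma free_tensor_injective (V W : zmodType) (g : {additive V -> W}) :
  injective g -> injective (tensor_mapr A g).
Proof.
move=> g_inj; apply: raddf_inj => t t0; have [s sE] := tensor_coord_sum t.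
rewrite (sE (undup s)) ?undup_uniq //; last by move=> x; rewrite mem_undup.
rewrite big1 // => x _.
have cg : tensor_coord W x \o tensor_mapr A g =1 g \o tensor_coord V x.
  apply: tensor_hom_ext => a b; rewrite /= tensor_maprE !tensor_coordE.
  by rewrite raddfMz.
suff -> : tensor_coord V x t = 0 by rewrite tens0r.
by apply: g_inj; rewrite raddf0; have := cg t; rewrite /= t0 raddf0 => <-.
Qed.

End FreeFlat.

(** * Consequences of the vanishing of Tor *)

Lemma ker_corestrict (P V U : zmodType) (f : {additive V -> U}) (g : {additive P -> V}) :
  (forall x, f (g x) = 0) ->
  {g' : {additive P -> ker_of f} | forall x, ker_incl f (g' x) = g x}.
Proof.
move=> fg; have kg x : g x \in additive_kernel f by rewrite unfold_in fg.
have gB : zmod_morphism (fun x => KerOf (kg x)).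
  by move=> x y; apply: val_inj; rewrite [RHS]raddfB; exact: raddfB.
by exists (additive_of gB).
Qed.

Lemma ker_inclP (V U : zmodType) (f : {additive V -> U}) x : f (ker_incl f x) = 0.
Proof. by case: x => x /= /eqP. Qed.

Section TorInjective.
Variables (X : choiceType) (U N : zmodType) (f : {additive {freeg X / int} -> U}).
Hypothesis f_surj : forall u, exists a, f a = u.
Local Notation A := {freeg X / int}.

(** Tor is computed from the free abelian group on the set U, whereas here the
    cover of U is A.  The lifts phi and psi of the identity of U compare them:
    phi kills t because Tor = 0, while psi phi fixes t, since psi phi - id maps
    all of A into ker f and t vanishes over A. *)
Lemma tor_zero_injective (t : tensor (ker_of f) N) : is_zero (Tor U N) ->
  @tensor_map _ _ N (ker_incl f) t = 0 -> t = 0.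
Proof.
move=> Tor0 t0; pose s u := projT1 (cid (f_surj u)).
have sK u : f (s u) = u by rewrite /s; case: cid.
pose phi : {additive A -> {freeg U / int}} := free_ab_lift (fun x => << f << x >> >>).
pose psi : {additive {freeg U / int} -> A} := free_ab_lift s.
have cover_phi : tor_cover U \o phi =1 f.
  by apply: freeg_hom_ext => x; rewrite /= !free_ab_liftU.
have f_psi : f \o psi =1 tor_cover U.
  by apply: freeg_hom_ext => x; rewrite /= !free_ab_liftU sK.
have [|phi' phi'E] := @ker_corestrict _ _ _ (tor_cover U) (phi \o ker_incl f).
  by move=> x; rewrite -(ker_inclP x); exact: cover_phi.
have [|psi' psi'E] := @ker_corestrict _ _ _ f (psi \o ker_incl (tor_cover U)).
  by move=> x; rewrite -(ker_inclP x); exact: f_psi.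
have hB : zmod_morphism (fun a => psi (phi a) - a).
  move=> a b; rewrite (raddfB phi) (raddfB psi) !opprB addrACA [RHS]addrACA.
  by rewrite (addrC (- psi _)).
have [|h hE] := @ker_corestrict _ _ _ f (additive_of hB).
  move=> a; rewrite /= raddfB; have /= -> := f_psi (phi a).
  by have /= -> := cover_phi a; rewrite subrr.
have phi_t : @tensor_map _ _ N phi' t = 0.
  have k0 : @tensor_map _ _ N phi' t \in additive_kernel (@tensor_map _ _ N (@tor_incl U)).
    have sq : @tensor_map _ _ N (@tor_incl U) \o @tensor_map _ _ N phi' =1
              @tensor_map _ _ N phi \o @tensor_map _ _ N (ker_incl f).
      by apply: tensor_hom_ext => a b; rewrite /= !tensor_mapE; congr tens; exact: phi'E.
    by apply/eqP; have := sq t; rewrite /= t0 raddf0.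
  by have := congr1 \val (Tor0 (KerOf k0)).
have comp : @tensor_map _ _ N psi' \o @tensor_map _ _ N phi' =1
    idfun \+ (@tensor_map _ _ N h \o @tensor_map _ _ N (ker_incl f)).
  apply: tensor_hom_ext => a b; rewrite /= !tensor_mapE -tensDl; congr tens.
  apply: val_inj; rewrite -![\val _]/(ker_incl f _) raddfD.
  rewrite psi'E hE /=; have /= -> := congr1 psi (phi'E a).
  by rewrite addrC subrK.
by have := comp t; rewrite /= phi_t t0 !raddf0 addr0 => <-.
Qed.

End TorInjective.

(** With A' and B' the kernels of f and g, the subgroups A' (x) B and A (x) B'
    of A (x) B meet in A' (x) B'.  In A (x) W the element v dies, so
    u dies already in A' (x) W by [tor_zero_injective]; right exactness then
    provides t. *)
Lemma tensor_exact_square (X : choiceType) (B U W : zmodType)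
    (f : {additive {freeg X / int} -> U}) (g : {additive B -> W})
    (u : tensor (ker_of f) B) (v : tensor {freeg X / int} (ker_of g)) :
  (forall u, exists a, f a = u) -> (forall w, exists b, g b = w) ->
  is_zero (Tor U W) ->
  @tensor_map _ _ B (ker_incl f) u = tensor_mapr _ (ker_incl g) v ->
  exists t, u = tensor_mapr _ (ker_incl g) t /\ v = @tensor_map _ _ _ (ker_incl f) t.
Proof.
move=> f_surj g_surj Tor0 uv.
have u0 : tensor_mapr (ker_of f) g u = 0.
  apply: (tor_zero_injective f_surj Tor0).
  have sq : @tensor_map _ _ W (ker_incl f) \o tensor_mapr (ker_of f) g =1
      tensor_mapr _ g \o @tensor_map _ _ B (ker_incl f).
    by apply: tensor_hom_ext => a b; rewrite /= tensor_maprE !tensor_mapE tensor_maprE.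
  have zr : tensor_mapr {freeg X / int} g \o tensor_mapr _ (ker_incl g) =1
      (fun _ => 0).
    apply: (tensor_hom_ext (g := \0)) => a b.
    by rewrite /= !tensor_maprE ker_inclP tens0r.
  by apply: (etrans (sq u)); rewrite /= uv; exact: zr.
have [t tE] := tensor_right_exact g_surj u0; exists t; split=> //.
apply: (free_tensor_injective (g := ker_incl g)); first exact: val_inj.
rewrite -uv -tE.
have sq : @tensor_map _ _ B (ker_incl f) \o tensor_mapr (ker_of f) (ker_incl g) =1
    tensor_mapr _ (ker_incl g) \o @tensor_map _ _ _ (ker_incl f).
  by apply: tensor_hom_ext => a b; rewrite /= !tensor_maprE !tensor_mapE tensor_maprE.
exact: sq.
Qed.

Local Close Scope ring_scope.

(** * Central commutator pairings and free abelianizations *)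

Section AdditiveGroup.
Variable V : zmodType.
(** The group V written multiplicatively, a target for [free_group_lift]. *)
Definition add_group : Type := V.
HB.instance Definition _ := Choice.on add_group.
HB.instance Definition _ := isGroup.Build add_group
  (@addrA V) (@add0r V) (@addr0 V) (@addNr V) (@addrN V).
End AdditiveGroup.

Section CenterZmodule.
Variable Q : groupType.

Lemma centerP z : reflect (central z) (z \in @center Q).
Proof. exact: asboolP. Qed.

Definition center_zmod : Type := subgroup_of (@center Q).
HB.instance Definition _ := Choice.on center_zmod.

Lemma center_mulC (x y : subgroup_of (@center Q)) : x * y = y * x.
Proof. by apply: val_inj; rewrite !valM; have /asboolP := valP x; apply. Qed.

HB.instance Definition _ := GRing.isZmodule.Build center_zmod
  (@mulgA (subgroup_of (@center Q))) center_mulC (@mul1g (subgroup_of (@center Q)))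
  (@mulVg (subgroup_of (@center Q))).

Definition cval (z : center_zmod) : Q := subgroup_val z.

Lemma cvalD (x y : center_zmod) : cval (x + y)%R = cval x * cval y.
Proof. exact: (@valM _ _ (subgroup_of (@center Q))). Qed.
Lemma cval0 : cval 0%R = 1.
Proof. by []. Qed.
Lemma cvalN (x : center_zmod) : cval (- x)%R = (cval x)^-1.
Proof. by apply/esym/mulg1_eq; rewrite -cvalD addrN. Qed.
Lemma cval_inj : injective cval. Proof. exact: val_inj. Qed.

End CenterZmodule.

Section CentralPairing.
Variables (E1 E2 Q : groupType).
Variables (a : {multiplicative E1 -> Q}) (b : {multiplicative E2 -> Q}).
Hypothesis ab_central : forall x y, central [~ a x, b y].
Variables (U W : zmodType) (pU : E1 -> U) (pW : E2 -> W).
Hypothesis pU_add : forall x x', pU (x * x') = (pU x + pU x')%R.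
Hypothesis pW_add : forall y y', pW (y * y') = (pW y + pW y')%R.
Hypothesis pU_surj : forall u, exists x, pU x = u.
Hypothesis pW_surj : forall w, exists y, pW y = w.
Hypothesis pU_ker : forall x y, pU x = 0%R -> commute (a x) (b y).
Hypothesis pW_ker : forall x y, pW y = 0%R -> commute (a x) (b y).

(** Commutators with central values are bimultiplicative, so they factor
    through a tensor product. *)
Lemma central_pairing : exists theta : {additive tensor U W -> center_zmod Q},
  forall x y, cval (theta (tens (pU x) (pW y))) = [~ a x, b y].
Proof.
have Dl x x' y : [~ a (x * x'), b y] = [~ a x, b y] * [~ a x', b y].
  by rewrite hom_mul comm_mull_central //; exact: ab_central.
have Dr x y y' : [~ a x, b (y * y')] = [~ a x, b y] * [~ a x, b y'].
  by rewrite hom_mul comm_mulr_central; exact: ab_central.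
pose beta x y : center_zmod Q := SubgroupOf (introT (centerP _) (@ab_central x y)).
have betaE x y : cval (beta x y) = [~ a x, b y] by [].
have pU_eq x x' y : pU x = pU x' -> [~ a x, b y] = [~ a x', b y].
  move=> pxx; have -> : x' = x * (x^-1 * x') by rewrite mulVKg.
  suff k : pU (x^-1 * x') = 0%R.
    by rewrite Dl; have /comm_eq1 -> := pU_ker y k; rewrite mulg1.
  by apply: (addrI (pU x)); rewrite -pU_add mulVKg addr0.
have pW_eq x y y' : pW y = pW y' -> [~ a x, b y] = [~ a x, b y'].
  move=> pyy; have -> : y' = y * (y^-1 * y') by rewrite mulVKg.
  suff k : pW (y^-1 * y') = 0%R.
    by rewrite Dr; have /comm_eq1 -> := pW_ker x k; rewrite mulg1.
  by apply: (addrI (pW y)); rewrite -pW_add mulVKg addr0.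
pose sU u := projT1 (cid (pU_surj u)).
have sUK u : pU (sU u) = u by rewrite /sU; case: cid.
pose sW w := projT1 (cid (pW_surj w)).
have sWK w : pW (sW w) = w by rewrite /sW; case: cid.
have [||theta thetaE] := @tensor_lift U W (center_zmod Q) (fun u w => beta (sU u) (sW w)).
- move=> w u u'; apply: cval_inj; rewrite cvalD !betaE -Dl; apply: pU_eq.
  by rewrite pU_add !sUK.
- move=> u w w'; apply: cval_inj; rewrite cvalD !betaE -Dr; apply: pW_eq.
  by rewrite pW_add !sWK.
exists theta => x y; rewrite thetaE betaE.
by rewrite (pU_eq _ x) ?sUK // (pW_eq _ _ y) ?sWK.
Qed.

Lemma zero_pairing : is_zero (tensor U W) -> forall x y, commute (a x) (b y).
Proof.
move=> UW0 x y; have [theta thetaE] := central_pairing.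
by apply/comm_eq1; rewrite -thetaE (UW0 (tens _ _)) raddf0 cval0.
Qed.

End CentralPairing.

Section AbelianQuotientMap.
Variables (E : groupType) (N : groupClosed E).
Hypothesis commN : forall x y : E, [~ x, y] \in N.

Lemma abq_mul x y : abq commN (x * y) = (abq commN x + abq commN y)%R.
Proof. by rewrite -abq_addE. Qed.

Lemma abq_eq0 x : abq commN x = 0%R <-> x \in N.
Proof. by rewrite -[0%R]/(abq commN 1) abqP mulg1 gpredV. Qed.

Lemma abq_surj u : exists x, abq commN x = u.
Proof. by exists (repr u); exact: abqK. Qed.

End AbelianQuotientMap.

Notation ab_class G := (abq (@derived_comm G)).

Section HomImage.
Variables (E F : groupType) (f : {multiplicative E -> F}) (A : groupClosed E).
Definition hom_image : {pred F} := fun y => `[< exists x, x \in A /\ f x = y >].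
Lemma hom_image_mul : mulg_closed hom_image.
Proof.
move=> _ _ /asboolP[x [Ax <-]] /asboolP[y [Ay <-]]; apply/asboolP.
by exists (x * y); rewrite gmulfM; split=> //; exact: gpredM.
Qed.
Lemma hom_image_one : 1 \in hom_image.
Proof. by apply/asboolP; exists 1; rewrite hom_one gpred1. Qed.
Lemma hom_image_inv : invg_closed hom_image.
Proof.
move=> _ /asboolP[x [Ax <-]]; apply/asboolP.
by exists x^-1; rewrite hom_inv; split=> //; exact: gpredVr.
Qed.
HB.instance Definition _ := isMulClosed.Build F hom_image hom_image_mul.
HB.instance Definition _ := isMul1Closed.Build F hom_image hom_image_one.
HB.instance Definition _ := isInvClosed.Build F hom_image hom_image_inv.
End HomImage.

Lemma abelianization_kernel (E G : groupType) (f : {multiplicative E -> G}) :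
  (forall g, exists x, f x = g) ->
  forall x, ab_class G (f x) = 0%R ->
  exists c r, [/\ c \in gamma E 2, r \in kernel f & x = c * r].
Proof.
move=> f_surj x /abq_eq0 fx.
have /asboolP[c [Ec cE]] : f x \in hom_image f (gamma E 2).
  move: (f x) fx; apply: commutator_min => g h _ _.
  have [u <-] := f_surj g; have [v <-] := f_surj h; apply/asboolP.
  by exists [~ u, v]; rewrite hom_comm; split=> //; exact: mem_commutator.
exists c, (c^-1 * x); split=> //; last by rewrite mulVKg.
by apply/eqP; rewrite gmulfM hom_inv cE mulVg.
Qed.

Section FreeAbelianization.
Variable X : choiceType.
Local Notation A := {freeg X / int}.

Definition free_ab : {multiplicative free_group X -> add_group A} :=
  sval (free_group_lift (fun x => << x >> : add_group A)).

(** The map [free_ab] with its values in the additive group itself. *)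
Definition free_abz (w : free_group X) : A := free_ab w.

Lemma free_abz_gen x : free_abz (gen x) = << x >>.
Proof. by rewrite /free_abz /free_ab; case: free_group_lift => f /= ->. Qed.

Lemma free_abzM v w : free_abz (v * w) = (free_abz v + free_abz w)%R.
Proof. exact: (hom_mul free_ab). Qed.

Lemma free_abzV w : free_abz w^-1 = (- free_abz w)%R.
Proof. exact: (hom_inv free_ab). Qed.

Lemma free_abz_surj a : exists w, free_abz w = a.
Proof.
move: a; apply: freeg_ind => [|_ _ [v <-] [w <-]|x].
- by exists 1; exact: (hom_one free_ab).
- by exists (v * w^-1); rewrite free_abzM free_abzV.
- by exists (gen x); exact: free_abz_gen.
Qed.

Lemma free_abz_ext (V : zmodType) (f : {additive A -> V}) (g : free_group X -> V) :
  (forall v w, g (v * w) = (g v + g w)%R) ->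
  (forall x, f << x >> = g (gen x)) -> forall w, f (free_abz w) = g w.
Proof.
move=> gM fg w; have g'M : {morph (g : free_group X -> add_group V) : v w / v * w}.
  exact: gM.
have fM : {morph (f : add_group A -> add_group V) : v w / v * w}.
  exact: raddfD.
apply: (free_group_hom_ext (f := hom_of fM \o free_ab) (g := hom_of g'M)) => x /=.
by rewrite -fg -free_abz_gen.
Qed.

Lemma free_abz_eq0 w : free_abz w = 0%R <-> w \in gamma (free_group X) 2.
Proof.
split=> [w0|].
  apply/(abq_eq0 (@derived_comm _)).
  rewrite -(free_abz_ext (f := free_ab_lift (fun x => ab_class _ (gen x)))).
  - by rewrite w0 raddf0.
  - by move=> u v; exact: abq_mul.
  - by move=> x; exact: free_ab_liftU.
move=> gw; suff: w \in kernel free_ab by move/eqP.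
move: w gw; apply: gamma_min => u v _; apply/eqP; rewrite hom_comm.
by apply/comm_eq1; exact: addrC.
Qed.

End FreeAbelianization.

(** * A Heisenberg group over a tensor product *)

Section SubgroupInclusion.
Variables (E : groupType) (A : groupClosed E).

Lemma subgroup_valM : {morph @subgroup_val E A : x y / x * y}.
Proof. exact: (@valM _ _ (subgroup_of A)). Qed.

Definition sub_incl : {multiplicative subgroup_of A -> E} := hom_of subgroup_valM.

Lemma sub_inclP x : sub_incl x \in A. Proof. by case: x. Qed.

Lemma sub_incl_surj y : y \in A -> exists x, sub_incl x = y.
Proof. by move=> Ay; exists (SubgroupOf Ay). Qed.
End SubgroupInclusion.
Arguments sub_incl {E A}.

Section Heisenberg.
Variables A B : zmodType.

(** Upper unitriangular matrices of size 3 with entries in A, B and, in the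
    corner, A (x) B. *)
Definition heis : Type := (A * B * tensor A B)%type.
HB.instance Definition _ := Choice.on heis.

Definition heis_mul (x y : heis) : heis :=
  ((x.1.1 + y.1.1, x.1.2 + y.1.2), x.2 + y.2 + tens x.1.1 y.1.2)%R.
Definition heis_inv (x : heis) : heis :=
  ((- x.1.1, - x.1.2), tens x.1.1 x.1.2 - x.2)%R.

Lemma heis_mulA : associative heis_mul.
Proof.
move=> x y z; rewrite /heis_mul /= !addrA; congr (_, _).
rewrite tensDl tensDr -!addrA; do 2!congr (_ + _)%R.
by rewrite [RHS]addrCA; congr (_ + _)%R; rewrite addrC -addrA.
Qed.
Lemma heis_mul1 : left_id ((0, 0), 0)%R heis_mul.
Proof. by move=> [[a b] t]; rewrite /heis_mul /= tens0l addr0 !add0r. Qed.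
Lemma heis_1mul : right_id ((0, 0), 0)%R heis_mul.
Proof. by move=> [[a b] t]; rewrite /heis_mul /= tens0r !addr0. Qed.
Lemma heis_mulV : left_inverse ((0, 0), 0)%R heis_inv heis_mul.
Proof.
move=> [[a b] t]; rewrite /heis_mul /= !addNr tensNl subrK.
by rewrite addrN.
Qed.
Lemma heis_mulgV : right_inverse ((0, 0), 0)%R heis_inv heis_mul.
Proof.
move=> [[a b] t]; rewrite /heis_mul /= !addrN tensNr addrCA addrN addr0.
by rewrite addrN.
Qed.
HB.instance Definition _ :=
  isGroup.Build heis heis_mulA heis_mul1 heis_1mul heis_mulV heis_mulgV.

Lemma heis_mulE (x y : heis) : x * y = heis_mul x y. Proof. by []. Qed.
Lemma heis_invE (x : heis) : x^-1 = heis_inv x. Proof. by []. Qed.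

Lemma heis_comm (x y : heis) :
  [~ x, y] = ((0, 0), tens x.1.1 y.1.2 - tens y.1.1 x.1.2)%R.
Proof.
apply: (@mulgI _ (y * x)); rewrite -commgC.
case: x y => [[a b] t] [[a' b'] t'].
rewrite !heis_mulE /heis_mul /= !addr0 tens0r addr0 (addrC a' a) (addrC b' b).
by congr (_, _); rewrite -[RHS]addrA (addrC (tens a' b)) subrK (addrC t').
Qed.

Definition heis_center : {pred heis} := fun x => `[< x.1 = (0, 0)%R >].
Lemma heis_center_mul : mulg_closed heis_center.
Proof.
move=> x y /asboolP x0 /asboolP y0; apply/asboolP.
by rewrite heis_mulE /heis_mul x0 y0 /= !addr0.
Qed.
Lemma heis_center_one : 1 \in heis_center. Proof. exact/asboolP. Qed.
Lemma heis_center_inv : invg_closed heis_center.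
Proof.
by move=> x /asboolP x0; apply/asboolP; rewrite heis_invE /heis_inv x0 /= !oppr0.
Qed.
HB.instance Definition _ := isMulClosed.Build heis heis_center heis_center_mul.
HB.instance Definition _ := isMul1Closed.Build heis heis_center heis_center_one.
HB.instance Definition _ := isInvClosed.Build heis heis_center heis_center_inv.

(** Commutators land in the corner, which is central. *)
Lemma heis_gamma3 (z : heis) : z \in gamma heis 3 -> z = 1.
Proof.
have c2 (x : heis) : x \in gamma heis 2 -> x.1 = (0, 0)%R.
  move=> gx; suff: x \in heis_center by move/asboolP.
  move: x gx; apply: gamma_min => x y _.
  by apply/asboolP; rewrite heis_comm.
move=> gz; suff: z \in kernel (idfun : {multiplicative heis -> heis}) by move/eqP.
move: z gz; apply: gamma_min => x y /c2 x0; apply/eqP; rewrite /= heis_comm x0 /=.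
by rewrite tens0l tens0r subr0.
Qed.

End Heisenberg.

(** * Mixed relators in the third term of the lower central series *)

Section RelatorClasses.
Variables (G : groupType) (P : free_presentation G).
Local Notation E := (free_group (fp_gens P)).

(** The projection of the abelianized free group onto the abelianization of G. *)
Definition pres_ab : {additive {freeg (fp_gens P) / int} -> abelianization G} :=
  free_ab_lift (fun x => ab_class G (fp_map P (gen x))).

Lemma pres_abE w : pres_ab (free_abz w) = ab_class G (fp_map P w).
Proof.
apply: (free_abz_ext (g := fun w => ab_class G (fp_map P w))) => [u v|x].
  by rewrite hom_mul abq_mul.
exact: free_ab_liftU.
Qed.

Lemma pres_ab_surj u : exists a, pres_ab a = u.
Proof.
have [g <-] := abq_surj u; have [w <-] := fp_surj P g.
by exists (free_abz w); exact: pres_abE.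
Qed.

Lemma relator_class_proof (r : subgroup_of (relators P)) :
  free_abz (sub_incl r) \in additive_kernel pres_ab.
Proof.
have /eqP Rr := sub_inclP r; rewrite unfold_in pres_abE Rr.
by apply/eqP/abq_eq0; exact: gpred1.
Qed.

(** The image of R in the abelianized free group is exactly the kernel of
    [pres_ab]; see [relator_class_surj]. *)
Definition relator_class r : ker_of pres_ab := KerOf (relator_class_proof r).

Lemma relator_classE r : ker_incl pres_ab (relator_class r) = free_abz (sub_incl r).
Proof. by []. Qed.

Lemma relator_classM r r' :
  relator_class (r * r') = (relator_class r + relator_class r')%R.
Proof.
apply: val_inj; rewrite -![\val _]/(ker_incl _ _) raddfD !relator_classE.
by rewrite hom_mul free_abzM.
Qed.

Lemma relator_class_surj a : exists r, relator_class r = a.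
Proof.
have [w wE] := free_abz_surj (ker_incl pres_ab a).
have := ker_inclP a; rewrite -wE pres_abE => /(abelianization_kernel (fp_surj P)).
case=> c [r [gc Rr w_cr]]; exists (SubgroupOf Rr); apply: val_inj.
rewrite -![\val _]/(ker_incl _ _) relator_classE -wE w_cr free_abzM.
by have /free_abz_eq0 -> := gc; rewrite add0r.
Qed.

Lemma relator_class_eq0 r : relator_class r = 0%R -> sub_incl r \in gamma E 2.
Proof. by move=> r0; apply/free_abz_eq0; rewrite -relator_classE r0 raddf0. Qed.

End RelatorClasses.

Section BaseCase.
Variables (G H : groupType) (PG : free_presentation G) (PH : free_presentation H).

Local Notation F1 := (free_group (fp_gens PG)).
Local Notation F2 := (free_group (fp_gens PH)).
Local Notation F := (free_product F1 F2).
Local Notation i1 := (fp_inl F1 F2).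
Local Notation i2 := (fp_inr F1 F2).
Local Notation p1 := (fp_prl F1 F2).
Local Notation p2 := (fp_prr F1 F2).
Local Notation K := (cartesian F1 F2).
Local Notation fG := (fp_map PG).
Local Notation fH := (fp_map PH).

Variable S : groupClosed F.
Hypothesis rel : relator_system S (relators PG) (relators PH).
Let nS := rel_normal rel.

Local Notation A := {freeg (fp_gens PG) / int}.
Local Notation B := {freeg (fp_gens PH) / int}.
Local Notation V := (subgroupI K S).

(** Modulo S_1 gamma_3 commutators of F1 and F2 are central, and vanish when one
    entry is a relator or in gamma_2; they are a pairing of G^ab and H^ab. *)
Lemma comm_gamma3 : is_zero (tensor (abelianization G) (abelianization H)) ->
  forall x y,
  [~ i1 x, i2 y] \in subgroup_prod (iter_commutator S 1) (@gamma_normal F 3).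
Proof.
move=> GH0 x y; have nS1 := iter_commutator_normal (c := 1) nS.
have nP := subgroup_prod_normal (nB := @gamma_normal F 3) nS1.
have [Q [q [qP q_surj]]] := quotient_exists nP; apply/(quotient_commute qP).
have qS s z : s \in S -> commute (q s) (q z).
  by move=> Ss; apply/(quotient_commute qP)/subgroup_prodl/mem_commutator.
have q2 g z : g \in gamma F 2 -> commute (q g) (q z).
  by move=> gg; apply/(quotient_commute qP)/subgroup_prodr/mem_gammaS.
apply: (@zero_pairing _ _ _ (q \o i1) (q \o i2) _ _ _
  (fun x => ab_class G (fG x)) (fun y => ab_class H (fH y))) => //=.
- move=> {}x {}y; rewrite -hom_comm; apply: (quotient_central qP) => // z.
  exact/subgroup_prodr/mem_gammaS/mem_commutator.
- by move=> u v; rewrite hom_mul abq_mul.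
- by move=> u v; rewrite hom_mul abq_mul.
- move=> u; have [g <-] := abq_surj u; have [z <-] := fp_surj PG g.
  by exists z.
- move=> u; have [h <-] := abq_surj u; have [z <-] := fp_surj PH h.
  by exists z.
- move=> u v /(abelianization_kernel (fp_surj PG))[c [r [gc Rr ->]]].
  rewrite !hom_mul; apply/commute_sym/commuteM; apply: commute_sym.
    by apply: q2; exact: hom_gamma.
  by apply: qS; exact: (rel_inl rel).
- move=> u v /(abelianization_kernel (fp_surj PH))[c [r [gc Rr ->]]].
  rewrite !hom_mul; apply: commuteM; apply: commute_sym.
    by apply: q2; exact: hom_gamma.
  by apply: qS; exact: (rel_inr rel).
Qed.

(** This homomorphism detects F1^ab (x) F2^ab inside gamma_2(F)/gamma_3(F). *)
Lemma heis_class_exists : exists eta : {multiplicative F -> heis A B},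
  forall f, (eta f).1 = (free_abz (p1 f), free_abz (p2 f)).
Proof.
have lM : {morph (fun x : F1 => ((free_abz x, 0), 0)%R : heis A B) : x y / x * y}.
  by move=> x y; rewrite heis_mulE /heis_mul /= free_abzM tens0r !addr0.
have rM : {morph (fun y : F2 => ((0, free_abz y), 0)%R : heis A B) : x y / x * y}.
  by move=> x y; rewrite heis_mulE /heis_mul /= free_abzM tens0l !addr0.
have [eta [eta_l eta_r]] := free_product_lift (hom_of lM) (hom_of rM).
have ab1 (X : choiceType) : free_abz (1 : free_group X) = 0%R.
  exact: (hom_one (@free_ab X)).
exists eta; apply: free_product_ind => [|x w IHw|y w IHw].
- by rewrite !hom_one !ab1.
- rewrite !(hom_mul eta) heis_mulE /heis_mul /= IHw eta_l /= !(hom_mul p1) !(hom_mul p2).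
  by rewrite !fp_prE !free_abzM ab1.
- rewrite !(hom_mul eta) heis_mulE /heis_mul /= IHw eta_r /= !(hom_mul p1) !(hom_mul p2).
  by rewrite !fp_prE !free_abzM ab1.
Qed.

Section Degree2.
Variables (Q : groupType) (q : {multiplicative F -> Q}).
Hypothesis qS2 : forall x, q x = 1 <-> x \in iter_commutator S 2.
Hypothesis q_surj : forall y, exists x, q x = y.

Let q_central s : s \in iter_commutator S 1 -> central (q s).
Proof. by move=> Ss; apply: (quotient_central qS2) => // z; exact: mem_iter_commutatorS. Qed.

Let q_gamma2 s g : s \in S -> g \in gamma F 2 -> commute (q s) (q g).
Proof.
move=> Ss gg; apply/(quotient_commute qS2).
exact: (iter_commutator_gamma (j := 0) (k := 1)).
Qed.

(** The commutator [m, y] modulo S_2 is a pairing of M(G) and H^ab: it vanishes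
    for m in [R1, F1], and for y in gamma_2(F2) or in R2, the latter because m
    is in gamma_2(F). *)
Lemma multiplier_commutes_l m y :
  is_zero (tensor (nilpotent_multiplier PG 1) (abelianization H)) ->
  m \in relators PG -> m \in gamma F1 2 -> commute (q (i1 m)) (q (i2 y)).
Proof.
move=> MH0 Rm gm.
have Nm : m \in multiplier_num PG 1 by apply/andP.
have [x <-] := sub_incl_surj Nm.
apply: (@zero_pairing _ _ _ (q \o (i1 \o @sub_incl _ (multiplier_num PG 1))) (q \o i2) _ _ _
  (abq (@multiplier_comm _ PG 1)) (fun y => ab_class H (fH y))) => //=.
- move=> {}x {}y; rewrite -hom_comm; apply/q_central/mem_commutator => //.
  by have /andP[Rx _] := sub_inclP x; exact: (rel_inl rel).
- exact: abq_mul.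
- by move=> u v; rewrite hom_mul abq_mul.
- exact: abq_surj.
- move=> u; have [h <-] := abq_surj u; have [z <-] := fp_surj PH h.
  by exists z.
- move=> {}x {}y /abq_eq0 Dx; apply: q_central.
  exact: (hom_iter_commutator (f := i1) (rel_inl rel) (n := 1)).
- move=> {}x {}y /(abelianization_kernel (fp_surj PH))[c [r [gc Rr ->]]].
  have /andP[Rx gx] := sub_inclP x.
  rewrite !hom_mul; apply: commuteM.
    by apply: q_gamma2; [exact: (rel_inl rel)|exact: hom_gamma].
  by apply/commute_sym/q_gamma2; [exact: (rel_inr rel)|exact: hom_gamma].
Qed.

Lemma multiplier_commutes_r m x :
  is_zero (tensor (nilpotent_multiplier PH 1) (abelianization G)) ->
  m \in relators PH -> m \in gamma F2 2 -> commute (q (i2 m)) (q (i1 x)).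
Proof.
move=> MG0 Rm gm.
have Nm : m \in multiplier_num PH 1 by apply/andP.
have [y <-] := sub_incl_surj Nm.
apply: (@zero_pairing _ _ _ (q \o (i2 \o @sub_incl _ (multiplier_num PH 1))) (q \o i1) _ _ _
  (abq (@multiplier_comm _ PH 1)) (fun x => ab_class G (fG x))) => //=.
- move=> {}y {}x; rewrite -hom_comm; apply/q_central/mem_commutator => //.
  by have /andP[Ry _] := sub_inclP y; exact: (rel_inr rel).
- exact: abq_mul.
- by move=> u v; rewrite hom_mul abq_mul.
- exact: abq_surj.
- move=> u; have [g <-] := abq_surj u; have [z <-] := fp_surj PG g.
  by exists z.
- move=> {}y {}x /abq_eq0 Dy; apply: q_central.
  exact: (hom_iter_commutator (f := i2) (rel_inr rel) (n := 1)).
- move=> {}y {}x /(abelianization_kernel (fp_surj PG))[c [r [gc Rr ->]]].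
  have /andP[Ry gy] := sub_inclP y.
  rewrite !hom_mul; apply: commuteM.
    by apply: q_gamma2; [exact: (rel_inr rel)|exact: hom_gamma].
  by apply/commute_sym/q_gamma2; [exact: (rel_inl rel)|exact: hom_gamma].
Qed.

(** The mixed part of s, seen in F / S_2. *)
Local Notation d s := (q ((split_part s)^-1 * s)).

Let S1_prl s : s \in iter_commutator S 1 -> i1 (p1 s) \in iter_commutator S 1.
Proof.
move=> Ss; apply: (hom_iter_commutator (f := i1) (rel_inl rel)).
exact: (hom_iter_commutator (f := p1) (rel_prl rel)).
Qed.

Let S1_prr s : s \in iter_commutator S 1 -> i2 (p2 s) \in iter_commutator S 1.
Proof.
move=> Ss; apply: (hom_iter_commutator (f := i2) (rel_inr rel)).
exact: (hom_iter_commutator (f := p2) (rel_prr rel)).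
Qed.

Let dM s s' : s \in iter_commutator S 1 -> s' \in iter_commutator S 1 ->
  d (s * s') = d s * d s'.
Proof.
move=> Ss Ss'; have c1 := q_central (S1_prl Ss').
have dE z : d z = (q (split_part z))^-1 * q z by rewrite hom_mul hom_inv.
have PE z : q (split_part z) = q (i1 (p1 z)) * q (i2 (p2 z)) by exact: hom_mul.
have cd : central (d s).
  by apply/q_central/gpredM => //; rewrite gpredV; apply: gpredM; [exact: S1_prl|exact: S1_prr].
have -> : d (s * s') = (q (split_part s) * q (split_part s'))^-1 * (q s * q s').
  rewrite dE (hom_mul q s s') !PE; congr (_^-1 * _).
  rewrite (hom_mul p1) (hom_mul p2) (hom_mul i1) (hom_mul i2) !(hom_mul q).
  rewrite -!mulgA (mulgA (q (i1 (p1 s')))).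
  by rewrite (c1 (q (i2 (p2 s)))) -!mulgA.
rewrite invgM -mulgA (mulgA _ (q s)) -(dE s) mulgA -(cd (_^-1)) -mulgA.
by rewrite -(dE s').
Qed.


Section Expansion.
Variable eta : {multiplicative F -> heis A B}.
Hypothesis eta1 : forall f, (eta f).1 = (free_abz (p1 f), free_abz (p2 f)).

Local Notation fA := (pres_ab PG).
Local Notation fB := (pres_ab PH).

Variables (theta1 : {additive tensor (ker_of fA) B -> center_zmod Q})
          (theta2 : {additive tensor A (ker_of fB) -> center_zmod Q}).
Hypothesis theta1E : forall r y,
  cval (theta1 (tens (relator_class r) (free_abz y))) = [~ q (i1 (sub_incl r)), q (i2 y)].
Hypothesis theta2E : forall x r,
  cval (theta2 (tens (free_abz x) (relator_class r))) = [~ q (i1 x), q (i2 (sub_incl r))].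

Local Notation j1 := (@tensor_map _ _ B (ker_incl fA)).
Local Notation j2 := (tensor_mapr A (ker_incl fB)).

(** An element s of S_1 whose mixed part is given by u and v, as an element of
    the center of F/S_2 on the one hand and in the Heisenberg group on the
    other. *)
Definition expansion : {pred F} := fun s => `[<
  s \in iter_commutator S 1 /\ exists u v, d s = cval (theta1 u - theta2 v)%R /\
    eta s = ((0, 0), j1 u - j2 v)%R >].

Lemma expansion_mul : mulg_closed expansion.
Proof.
move=> s s' /asboolP[Ss [u [v [dE etaE]]]] /asboolP[Ss' [u' [v' [dE' etaE']]]].
apply/asboolP; split; first exact: gpredM.
exists (u + u')%R, (v + v')%R; rewrite dM // dE dE' -cvalD; split.
  by congr cval; rewrite (raddfD theta1) (raddfD theta2) opprD addrACA.
rewrite hom_mul etaE etaE' heis_mulE /heis_mul /= tens0l !addr0; congr (_, _).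
by rewrite (raddfD j1) (raddfD j2) opprD addrACA.
Qed.

Lemma expansion_one : 1 \in expansion.
Proof.
apply/asboolP; split; first exact: gpred1.
exists 0%R, 0%R.
rewrite (raddf0 theta1) (raddf0 theta2) (raddf0 j1) (raddf0 j2) !subr0; split; last exact: hom_one.
by rewrite /split_part !hom_one !mulg1 invg1 hom_one.
Qed.

Lemma expansion_inv : invg_closed expansion.
Proof.
move=> s /asboolP[Ss [u [v [dE etaE]]]]; apply/asboolP.
have SV : s^-1 \in iter_commutator S 1 by exact: gpredVr.
split=> //; exists (- u)%R, (- v)%R; split.
  rewrite (raddfN theta1) (raddfN theta2) -opprD cvalN -dE.
  apply/esym/mulg1_eq; rewrite -dM // mulgV.
  by rewrite /split_part !hom_one !mulg1 invg1 hom_one.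
rewrite hom_inv etaE heis_invE /heis_inv /= tens0l !oppr0 sub0r.
by rewrite (raddfN j1) (raddfN j2) opprB opprK addrC.
Qed.
HB.instance Definition _ := isMulClosed.Build F expansion expansion_mul.
HB.instance Definition _ := isMul1Closed.Build F expansion expansion_one.
HB.instance Definition _ := isInvClosed.Build F expansion expansion_inv.

(** For a generator [s, f] take u = r1 (x) y and v = x (x) r2, where r1 and r2 are
    the projections of s, and x and y those of f: the other two brackets
    [r1, x] and [r2, y] make up the split part. *)
Lemma expansionP s : s \in iter_commutator S 1 -> s \in expansion.
Proof.
move: s; apply: iter_commutator_min => s f Ss; apply/asboolP.
have S1 z : [~ s, z] \in iter_commutator S 1 by exact: mem_commutator.
split=> //.
have [r1 r1E] := sub_incl_surj (rel_prl rel Ss).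
have [r2 r2E] := sub_incl_surj (rel_prr rel Ss).
exists (tens (relator_class r1) (free_abz (p2 f))),
       (tens (free_abz (p1 f)) (relator_class r2)); split; last first.
  by rewrite hom_comm heis_comm !eta1 tensor_mapE tensor_maprE !relator_classE r1E r2E.
rewrite cvalD cvalN theta1E theta2E r1E r2E.
have Sa := rel_inl rel (rel_prl rel Ss); have Sb := rel_inr rel (rel_prr rel Ss).
have ca z : z \in S -> forall y, central [~ q z, y].
  move=> Sz y; have [y' <-] := q_surj y; rewrite -hom_comm.
  exact/q_central/mem_commutator.
pose k := (split_part f)^-1 * f.
have gk : k \in gamma F 2.
  have : k \in K by exact: split_cartesian.
  move: k; apply: cartesian_min; first exact: gamma_normal.
  by move=> x y; exact: mem_commutator.
have sE : q s = q (i1 (p1 s)) * q (i2 (p2 s)) * d s.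
  by rewrite -(hom_mul q) -(hom_mul q) mulVKg.
have fE : q f = q (i1 (p1 f)) * q (i2 (p2 f)) * q k.
  by rewrite -(hom_mul q) -(hom_mul q) mulVKg.
have cd : central (d s) by exact/q_central/(rel_split rel).
have qsf : q [~ s, f] = [~ q (i1 (p1 s)), q (i1 (p1 f))] *
    [~ q (i2 (p2 s)), q (i2 (p2 f))] *
    ([~ q (i1 (p1 s)), q (i2 (p2 f))] * [~ q (i1 (p1 f)), q (i2 (p2 s))]^-1).
  rewrite hom_comm sE comm_mull; have /comm_eq1 -> := cd (q f).
  rewrite mulg1 (commute_conj (commute_sym (cd _))) fE.
  by apply: comm_expand; [exact: ca|exact: ca|exact: q_gamma2|exact: q_gamma2].
rewrite hom_mul hom_inv qsf /split_part !(hom_comm p1) !(hom_comm p2).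
by rewrite (hom_mul q) !hom_comm mulKg.
Qed.

End Expansion.

(** In the Heisenberg group w is trivial, so u and v agree in A (x) B and come
    from A' (x) B', where theta1 and theta2 coincide. *)
Lemma degree2_trivial :
  is_zero (tensor (nilpotent_multiplier PG 1) (abelianization H)) ->
  is_zero (tensor (nilpotent_multiplier PH 1) (abelianization G)) ->
  is_zero (Tor (abelianization G) (abelianization H)) ->
  forall w, w \in V -> w \in gamma F 3 -> q w = 1.
Proof.
move=> MH0 MG0 Tor0 w Vw gw.
have [eta eta1] := heis_class_exists.
have [|||||||theta1 theta1E] := @central_pairing _ _ _
    (q \o (i1 \o @sub_incl _ (relators PG))) (q \o i2) _ _ _
    (@relator_class _ PG) (@free_abz _).
- move=> r y /=; rewrite -hom_comm; apply/q_central/mem_commutator => //.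
  by apply: (rel_inl rel); exact: sub_inclP.
- exact: relator_classM.
- exact: free_abzM.
- exact: relator_class_surj.
- exact: free_abz_surj.
- move=> r y /relator_class_eq0 gr /=.
  by apply: (multiplier_commutes_l) => //; exact: sub_inclP.
- move=> r y /free_abz_eq0 gy /=; apply: q_gamma2; last exact: hom_gamma.
  by apply: (rel_inl rel); exact: sub_inclP.
have [|||||||theta2 theta2E] := @central_pairing _ _ _
    (q \o i1) (q \o (i2 \o @sub_incl _ (relators PH))) _ _ _
    (@free_abz _) (@relator_class _ PH).
- move=> x r /=; rewrite -hom_comm; apply: q_central.
  rewrite -invgR gpredV; apply: mem_commutator => //.
  exact: (rel_inr rel (sub_inclP r)).
- exact: free_abzM.
- exact: relator_classM.
- exact: free_abz_surj.
- exact: relator_class_surj.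
- move=> x r /free_abz_eq0 gx /=; apply: commute_sym; apply: q_gamma2; last exact: hom_gamma.
  by apply: (rel_inr rel); exact: sub_inclP.
- move=> x r /relator_class_eq0 gr /=; apply: commute_sym.
  by apply: (multiplier_commutes_r) => //; exact: sub_inclP.
have /asboolP[_ [u [v [dw etaw]]]] := expansionP eta1 theta1E theta2E
  (cartesian_relators rel Vw).
have [Kw _] := andP Vw.
move: dw; rewrite split_part_cartesian // invg1 mul1g => qw.
rewrite qw.
have uv : @tensor_map _ _ _ (ker_incl (pres_ab PG)) u =
          tensor_mapr _ (ker_incl (pres_ab PH)) v.
  apply/eqP; rewrite -subr_eq0; apply/eqP.
  by have := heis_gamma3 (hom_gamma eta gw); rewrite etaw => -[].
have [t [-> ->]] := tensor_exact_square (@pres_ab_surj _ PG) (@pres_ab_surj _ PH) Tor0 uv.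
suff -> : theta1 (tensor_mapr _ (ker_incl (pres_ab PH)) t) =
    theta2 (@tensor_map _ _ _ (ker_incl (pres_ab PG)) t) by rewrite subrr cval0.
move: t; apply: (tensor_hom_ext (f := theta1 \o tensor_mapr _ (ker_incl (pres_ab PH)))
  (g := theta2 \o @tensor_map _ _ _ (ker_incl (pres_ab PG)))) => a b /=.
have [r <-] := relator_class_surj a; have [r' <-] := relator_class_surj b.
by apply: cval_inj; rewrite tensor_mapE tensor_maprE theta1E theta2E.
Qed.

End Degree2.

Lemma cartesian_degree2 :
  is_zero (tensor (nilpotent_multiplier PG 1) (abelianization H)) ->
  is_zero (tensor (nilpotent_multiplier PH 1) (abelianization G)) ->
  is_zero (Tor (abelianization G) (abelianization H)) ->
  forall w, w \in V -> w \in gamma F 3 -> w \in iter_commutator S 2.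
Proof.
move=> MH0 MG0 Tor0 w Vw gw.
have [Q [q [qS2 q_surj]]] := quotient_exists (iter_commutator_normal (c := 2) nS).
exact/qS2/(degree2_trivial qS2 q_surj).
Qed.

End BaseCase.

(** * The multiplier of a free product *)

Section CartesianMultiplier.
Variables (G H : groupType) (PG : free_presentation G) (PH : free_presentation H).

Local Notation F1 := (free_group (fp_gens PG)).
Local Notation F2 := (free_group (fp_gens PH)).
Local Notation F := (free_product F1 F2).
Local Notation K := (cartesian F1 F2).

Variable S : groupClosed F.
Hypothesis rel : relator_system S (relators PG) (relators PH).
Let nS := rel_normal rel.

Hypothesis GH0 : is_zero (tensor (abelianization G) (abelianization H)).
Hypothesis MH0 : is_zero (tensor (nilpotent_multiplier PG 1) (abelianization H)).
Hypothesis MG0 : is_zero (tensor (nilpotent_multiplier PH 1) (abelianization G)).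
Hypothesis Tor0 : is_zero (Tor (abelianization G) (abelianization H)).

(** Inclusion (I_c) for c = n+1. *)
Lemma cartesian_multiplier n w : w \in subgroupI K S -> w \in gamma F n.+2 ->
  w \in iter_commutator S n.+1.
Proof.
elim: n w => [|[|n] IHn] w Vw gw; first exact: (cartesian_relators rel).
  exact: (cartesian_degree2 rel).
apply: (inductive_step rel (comm_gamma3 rel GH0)) => // v Vv gv.
exact: (cartesian_degree2 rel).
Qed.

(** Injectivity on multipliers, for the presentation F / S of G * H: the split
    part of w is handled by the factors, the rest lies in the cartesian
    subgroup. *)
Lemma free_product_multiplier n w : w \in S -> w \in gamma F n.+2 ->
  fp_prl F1 F2 w \in iter_commutator (relators PG) n.+1 ->
  fp_prr F1 F2 w \in iter_commutator (relators PH) n.+1 ->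
  w \in iter_commutator S n.+1.
Proof.
move=> Sw gw D1 D2.
have Dsplit : split_part w \in iter_commutator S n.+1.
  apply: gpredM; first exact: (hom_iter_commutator (rel_inl rel) D1).
  exact: (hom_iter_commutator (rel_inr rel) D2).
have gsplit : split_part w \in gamma F n.+2.
  by apply: gpredM; apply: hom_gamma; exact: hom_gamma.
rewrite -(mulVKg (split_part w) w); apply: gpredM => //.
apply: cartesian_multiplier; last by rewrite gpredMl ?gpredV.
apply/andP; split; first exact: split_cartesian.
by rewrite gpredMl // gpredV (split_part_S rel).
Qed.

End CartesianMultiplier.

Section MultiplierClass.
Variables (G : groupType) (P : free_presentation G) (c : nat).

Definition multiplier_class x (Nx : x \in multiplier_num P c) :
  nilpotent_multiplier P c := abq (@multiplier_comm _ P c) (SubgroupOf Nx).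

Lemma multiplier_class_eq x y (Nx : x \in multiplier_num P c)
    (Ny : y \in multiplier_num P c) :
  multiplier_class Nx = multiplier_class Ny <-> x^-1 * y \in multiplier_den P c.
Proof.
rewrite /multiplier_class abqP unfold_in -[val _]/(sub_incl _).
by rewrite hom_mul hom_inv.
Qed.

Lemma multiplier_class_eq0 x (Nx : x \in multiplier_num P c) :
  multiplier_class Nx = 0%R <-> x \in multiplier_den P c.
Proof. by rewrite /multiplier_class abq_eq0. Qed.

Lemma multiplier_classM x y (Nx : x \in multiplier_num P c)
    (Ny : y \in multiplier_num P c) (Nxy : x * y \in multiplier_num P c) :
  multiplier_class Nxy = (multiplier_class Nx + multiplier_class Ny)%R.
Proof. by rewrite -abq_mul; congr abq; apply: val_inj; rewrite valM. Qed.

Lemma multiplier_class_surj m : exists x (Nx : x \in multiplier_num P c),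
  multiplier_class Nx = m.
Proof. by have [[x Nx] <-] := abq_surj m; exists x, Nx. Qed.

End MultiplierClass.

Section MultiplierMap.
Variables (G H : groupType) (P : free_presentation G) (P' : free_presentation H).
Variables (c : nat).
Variable f : {multiplicative free_group (fp_gens P) -> free_group (fp_gens P')}.
Hypothesis f_rel : forall r, r \in relators P -> f r \in relators P'.

Lemma multiplier_num_map x : x \in multiplier_num P c -> f x \in multiplier_num P' c.
Proof. by case/andP=> Rx gx; apply/andP; split; [exact: f_rel|exact: hom_gamma]. Qed.

Lemma multiplier_map_exists :
  {g : {additive nilpotent_multiplier P c -> nilpotent_multiplier P' c} |
    forall x (Nx : x \in multiplier_num P c) (Nfx : f x \in multiplier_num P' c),
      g (multiplier_class Nx) = multiplier_class Nfx}.
Proof.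
pose rep (m : nilpotent_multiplier P c) := sub_incl (repr m).
have repN m : rep m \in multiplier_num P c by exact: sub_inclP.
have repE m : multiplier_class (repN m) = m.
  by rewrite -[RHS]abqK; congr abq; apply: val_inj.
pose g m := multiplier_class (multiplier_num_map (repN m)).
have gE x (Nx : x \in multiplier_num P c) (Nfx : f x \in multiplier_num P' c) :
    g (multiplier_class Nx) = multiplier_class Nfx.
  apply/multiplier_class_eq; rewrite -hom_inv -hom_mul.
  apply: (hom_iter_commutator f_rel).
  by apply/(multiplier_class_eq (repN _) Nx).
have gB : zmod_morphism g.
  have gD : {morph g : x y / (x + y)%R}.
    move=> x y; rewrite -(repE x) -(repE y).
    have Nxy : rep x * rep y \in multiplier_num P c by exact: gpredM.
    rewrite -(multiplier_classM _ _ Nxy) (gE _ _ (multiplier_num_map Nxy)).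
    rewrite !(gE _ _ (multiplier_num_map (repN _))).
    have Nff : f (rep x) * f (rep y) \in multiplier_num P' c.
      by apply: gpredM; exact: multiplier_num_map.
    rewrite -(multiplier_classM _ _ Nff).
    by apply/multiplier_class_eq; rewrite hom_mul mulVg gpred1.
  by move=> x y; apply: (@addIr _ (g y)); rewrite -gD !subrK.
by exists (additive_of gB).
Qed.

End MultiplierMap.

Theorem theorem4p2 (G H : groupType)
    (PG : free_presentation G) (PH : free_presentation H)
    (PGH : free_presentation (free_product G H)) :
  is_zero (tensor (abelianization G) (abelianization H)) ->
  is_zero (tensor (nilpotent_multiplier PG 1) (abelianization H)) ->
  is_zero (tensor (nilpotent_multiplier PH 1) (abelianization G)) ->
  is_zero (Tor (abelianization G) (abelianization H)) ->
  forall c : nat, 1 <= c ->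
    exists f : {additive nilpotent_multiplier PGH c ->
                  nilpotent_multiplier PG c * nilpotent_multiplier PH c},
      bijective f.
Proof.
move=> GH0 MH0 MG0 Tor0 [//|c] _.
set F1 := free_group (fp_gens PG); set F2 := free_group (fp_gens PH).
set fG := fp_map PG; set fH := fp_map PH.
have [p [pl pr]] := free_product_lift (fp_inl G H \o fG) (fp_inr G H \o fH).
have p_surj z : exists x, p x = z.
  suff /asboolP[x [_ xz]] : z \in hom_image p (whole _) by exists x.
  move: z; apply: free_product_gen => [g|h]; apply/asboolP.
    by have [x <-] := fp_surj PG g; exists (fp_inl F1 F2 x); rewrite pl.
  by have [y <-] := fp_surj PH h; exists (fp_inr F1 F2 y); rewrite pr.
have rel : relator_system (kernel p) (relators PG) (relators PH).
  exact: (@kernel_relator_system _ _ _ _ fG fH (fp_surj PG) (fp_surj PH) p pl pr).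
(* lam and mu lift the identity of G * H from one presentation to the other. *)
have [lam lamE] := free_group_projective (fp_map PGH) p_surj.
have [mu1 mu1E] := free_group_projective (p \o fp_inl F1 F2) (fp_surj PGH).
have [mu2 mu2E] := free_group_projective (p \o fp_inr F1 F2) (fp_surj PGH).
have [mu [mul mur]] := free_product_lift mu1 mu2.
have muE x : fp_map PGH (mu x) = p x.
  apply: (free_product_hom_ext (f := fp_map PGH \o mu)) => y /=.
    by rewrite mul mu1E.
  by rewrite mur mu2E.
have lam_rel w : w \in relators PGH -> lam w \in kernel p.
  by move=> /eqP w1; apply/eqP; rewrite lamE.
have mu_rel x : x \in kernel p -> mu x \in relators PGH.
  by move=> /eqP x1; apply/eqP; rewrite muE.
have rel1 w : w \in relators PGH -> (fp_prl F1 F2 \o lam) w \in relators PG.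
  by move=> /lam_rel /(rel_prl rel).
have rel2 w : w \in relators PGH -> (fp_prr F1 F2 \o lam) w \in relators PH.
  by move=> /lam_rel /(rel_prr rel).
have [phi1 phi1E] := multiplier_map_exists c.+1 rel1.
have [phi2 phi2E] := multiplier_map_exists c.+1 rel2.
pose phi m := (phi1 m, phi2 m).
have phiB : zmod_morphism phi by move=> x y; rewrite /phi !raddfB.
have num1 w := @multiplier_num_map _ _ PGH PG c.+1 _ rel1 w.
have num2 w := @multiplier_num_map _ _ PGH PH c.+1 _ rel2 w.
have phi_inj : injective (additive_of phiB).
  apply: raddf_inj => m [].
  have [w [Nw <-]] := multiplier_class_surj m.
  rewrite (phi1E _ _ (num1 _ Nw)) (phi2E _ _ (num2 _ Nw)).
  move=> /multiplier_class_eq0 D1 /multiplier_class_eq0 D2.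
  apply/multiplier_class_eq0; have /andP[Rw gw] := Nw.
  have Dlam : lam w \in iter_commutator (kernel p) c.+1.
    apply: (free_product_multiplier rel) => //; first exact: lam_rel.
    exact: hom_gamma.
  have Dmu := hom_iter_commutator (f := mu) mu_rel Dlam.
  have close x : (idfun x)^-1 * (mu \o lam) x \in relators PGH.
    by apply/eqP; rewrite hom_mul hom_inv /= muE lamE mulVg.
  have Dw := lift_congr (@relators_normal _ PGH) close gw.
  rewrite -(invgK w) -(mulgK (mu (lam w)) w^-1).
  by apply/gpredVr/gpredM => //; exact: gpredVr.
have phi_surj z : exists m, phi m = z.
  case: z => m1 m2.
  have [w1 [Nw1 <-]] := multiplier_class_surj m1.
  have [w2 [Nw2 <-]] := multiplier_class_surj m2.
  have /andP[R1 g1] := Nw1; have /andP[R2 g2] := Nw2.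
  pose x := fp_inl F1 F2 w1 * fp_inr F1 F2 w2.
  have gx : x \in gamma (free_product F1 F2) c.+2 by apply: gpredM; exact: hom_gamma.
  have Nx : mu x \in multiplier_num PGH c.+1.
    apply/andP; split; last exact: hom_gamma.
    by apply/mu_rel/gpredM; [exact: (rel_inl rel)|exact: (rel_inr rel)].
  exists (multiplier_class Nx); rewrite /phi (phi1E _ _ (num1 _ Nx)) (phi2E _ _ (num2 _ Nx)).
  (* A projection of F lifts the same homomorphism as its composition with
     lam and mu, so lift_congr applies. *)
  congr pair; apply/esym/multiplier_class_eq.
    have -> : w1 = fp_prl F1 F2 x by rewrite hom_mul !fp_prE mulg1.
    apply: (lift_congr (f := fp_prl F1 F2) (g := (fp_prl F1 F2 \o lam) \o mu)) gx.
      exact: relators_normal.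
    move=> y; apply/eqP; rewrite hom_mul hom_inv /=.
    by rewrite !(fp_prl_map pl pr) lamE muE mulVg.
  have -> : w2 = fp_prr F1 F2 x by rewrite hom_mul !fp_prE mul1g.
  apply: (lift_congr (f := fp_prr F1 F2) (g := (fp_prr F1 F2 \o lam) \o mu)) gx.
    exact: relators_normal.
  move=> y; apply/eqP; rewrite hom_mul hom_inv /=.
  by rewrite !(fp_prr_map pl pr) lamE muE mulVg.
exists (additive_of phiB); exists (fun z => projT1 (cid (phi_surj z))) => [m|z].
  by apply: phi_inj; case: cid.
by case: cid.
Qed.
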